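(* Let $Y$ be as in the context and let $(t,d)\in\Upsilon$. Then $$m_t\prod_{h=t}^{t+d-1}b^*_hc^*_{t+d-h}=\sum_{(i,j)\in\Upsilon,\ (i,j)\preceq(t,d)}\mathrm{mult}(i,j)\prod_{h=t-i}^{t-i+d-1}b^*_h(i,j)\,c^*_{h+1}(i,j).$$
   Context: $Y=(X,\{R_i\}_{0\le i\le D})$ is a symmetric association scheme ($X$ finite; $R_i$ partition $X\times X$, $R_0$ diagonal, $R_i$ symmetric; $p^h_{ij}=|\{z:(x,z)\in R_i,(z,y)\in R_j\}|$ for $(x,y)\in R_h$ independent of $x,y$), with $D\ge3$, associate matrices $A_i$, Bose–Mesner algebra $M=\mathrm{span}\{A_i\}$ with primitive idempotents $E_0,\dots,E_D$ ($E_iE_j=\delta_{ij}E_i$, $\sum E_i=I$, $E_0=|X|^{-1}J$), multiplicities $m_i=\mathrm{rank}\,E_i$, and Krein parameters $q^h_{ij}$ ($E_i\circ E_j=|X|^{-1}\sum_hq^h_{ij}E_h$). $Y$ is P-polynomial w.r.t. $R_0,\dots,R_D$ ($p^h_{ij}=0$ if one of $h,i,j$ exceeds the sum of the other two, $\ne0$ if it equals that sum), almost-bipartite ($p^i_{1i}=0$ for $0\le i\le D-1$, $p^D_{1D}\ne0$), and Q-polynomial w.r.t. $E_0,\dots,E_D$ (same conditions for $q^h_{ij}$). Set $c^*_i=q^i_{1,i-1}$ ($1\le i\le D$), $b^*_i=q^i_{1,i+1}$ ($0\le i\le D-1$), $c^*_0=0$, $b^*_D=0$. $A=A_1$, $AE_i=\theta_iE_i$.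 Fix $x\in X$: $E^*_i$ diagonal with $(E^*_i)_{yy}=1$ iff $(x,y)\in R_i$; $A^*$ diagonal with $(A^* )_{yy}=|X|(E_1)_{xy}$; $A^*E^*_i=\theta^*_iE^*_i$. $T=T(x)$ is the algebra generated by $M$ and $\mathrm{span}\{E^*_i\}$. For an irreducible $T$-module $W\subseteq\mathbb{C}^X$, its dual endpoint is $\min\{i:E_iW\ne0\}$ and its diameter is $|\{i:E^*_iW\ne0\}|-1$. Fix a decomposition of $\mathbb{C}^X$ into an orthogonal direct sum of irreducible $T$-modules; $\mathrm{mult}(t,d)$ is the number of summands with dual endpoint $t$ and diameter $d$ (independent of the decomposition). $\Upsilon=\{(t,d)\in\mathbb{Z}^2:0\le d\le D,\ \tfrac12(D-d)\le t\le D-d\}$, with partial order $(t,d)\preceq(t',d')$ iff $t\le t'$ and $t'+d'\le t+d$. For $(t,d)\in\Upsilon$ put $r:=D-d$, $c^*_0(t,d)=0$, $b^*_d(t,d)=0$, and for $d\ge1$: $c^*_i(t,d)=\frac{(\theta^2_{t+i}-\theta^2_t)(\theta^*_{r+2}-\theta^*_{r+1})+(\theta_t\theta_{t+1}-\theta_{t+i}\theta_{t+i+1})(\theta^*_{r+1}-\theta^*_r)}{(\theta_{t+i-1}-\theta_{t+i})(\theta_{t+i-1}-\theta_{t+i+1})}$ ($1\le i\le d-1$), $c^*_d(t,d)=\frac{\theta_{t+d}(\theta^*_{r+1}-\theta^*_r)}{\theta_{t+d-1}-\theta_{t+d}}$, $b^*_0(t,d)=\frac{\theta_t(\theta^*_r-\theta^*_{r+1})}{\theta_t-\theta_{t+1}}$,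 $b^*_i(t,d)=\frac{(\theta^2_{t+i}-\theta^2_t)(\theta^*_{r+2}-\theta^*_{r+1})+(\theta_t\theta_{t+1}-\theta_{t+i}\theta_{t+i-1})(\theta^*_{r+1}-\theta^*_r)}{(\theta_{t+i+1}-\theta_{t+i})(\theta_{t+i+1}-\theta_{t+i-1})}$ ($1\le i\le d-1$). *)

(* Defs.v *)
From mathcomp Require Import all_boot all_order all_algebra.

Set Implicit Arguments.
Unset Strict Implicit.
Unset Printing Implicit Defensive.

Import GRing.Theory Num.Theory.
Local Open Scope ring_scope.

Record assoc_scheme (X : finType) (D : nat) := AssocScheme {
  srel : 'I_D.+1 -> {set X * X};
  (* pnum h i j is p^h_{ij}; the nonemptiness of srel h makes it unique *)
  pnum : 'I_D.+1 -> 'I_D.+1 -> 'I_D.+1 -> nat;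
  srel_neq0 : forall i, srel i != set0;
  srel_partition : forall y z, exists! i, (y, z) \in srel i;
  srel_diag : forall y z, ((y, z) \in srel ord0) = (y == z);
  srel_sym : forall i y z, (y, z) \in srel i -> (z, y) \in srel i;
  pnumP : forall h i j y z, (y, z) \in srel h ->
    #|[set w | ((y, w) \in srel i) && ((w, z) \in srel j)]| = pnum h i j
}.

(* The condition shared by the P-polynomial property (for p^h_{ij}) and the
   Q-polynomial property (for q^h_{ij}). *)
Definition polynomial_parameters (V : nmodType) (D : nat)
    (f : 'I_D.+1 -> 'I_D.+1 -> 'I_D.+1 -> V) : Prop :=
  forall h i j : 'I_D.+1,
    ([|| i + j < h, h + j < i | h + i < j]%N -> f h i j = 0) /\
    ([|| h == i + j :> nat, i == h + j :> nat | j == h + i :> nat]%N ->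
       f h i j <> 0).

Definition P_polynomial (X : finType) (D : nat) (Y : assoc_scheme X D) : Prop :=
  polynomial_parameters (pnum Y).

Definition almost_bipartite (X : finType) (D : nat) (Y : assoc_scheme X D)
    : Prop :=
  (forall i : 'I_D.+1, (i < D)%N -> pnum Y i (inord 1) i = 0%N) /\
  pnum Y ord_max (inord 1) ord_max <> 0%N.

Section Algebra.
Variables (C : numClosedFieldType) (X : finType) (D : nat).
Variable Y : assoc_scheme X D.

(* Rows and columns are indexed by X through enum_val : 'I_#|X| -> X. *)
Definition assoc_mx (i : 'I_D.+1) : 'M[C]_#|X| :=
  \matrix_(a, b) ((enum_val a, enum_val b) \in srel Y i)%:R.

Definition bose_mesner : {vspace 'M[C]_#|X|} :=
  <<[seq assoc_mx i | i : 'I_D.+1]>>%VS.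

(* D + 1 nonzero, pairwise orthogonal idempotents in the (D + 1)-dimensional
   algebra M are necessarily primitive. *)
Definition primitive_idempotents (E : 'I_D.+1 -> 'M[C]_#|X|) : Prop :=
  [/\ forall i, E i \in bose_mesner,
      forall i, E i != 0,
      forall i j, E i *m E j = if i == j then E i else 0,
      \sum_i E i = 1%:M
    & E ord0 = #|X|%:R^-1 *: const_mx 1].

(* q h i j is q^h_{ij}; the linear independence of the E h makes it unique. *)
Definition krein_parameters (E : 'I_D.+1 -> 'M[C]_#|X|)
    (q : 'I_D.+1 -> 'I_D.+1 -> 'I_D.+1 -> C) : Prop :=
  forall i j,
    map2_mx *%R (E i) (E j) = #|X|%:R^-1 *: \sum_h q h i j *: E h.

Definition Q_polynomial (q : 'I_D.+1 -> 'I_D.+1 -> 'I_D.+1 -> C) : Prop :=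
  polynomial_parameters q.

Definition dual_idem (x : X) (i : 'I_D.+1) : 'M[C]_#|X| :=
  diag_mx (\row_a ((x, enum_val a) \in srel Y i)%:R).

Definition dual_adj (E : 'I_D.+1 -> 'M[C]_#|X|) (x : X) : 'M[C]_#|X| :=
  diag_mx (\row_a (#|X|%:R * E (inord 1) (enum_rank x) a)).

Definition dual_bose_mesner (x : X) : {vspace 'M[C]_#|X|} :=
  <<[seq dual_idem x i | i : 'I_D.+1]>>%VS.

(* The identity matrix lies in bose_mesner, so it needs no clause. *)
Inductive terwilliger (x : X) : 'M[C]_#|X| -> Prop :=
| terwilliger_bm B : B \in bose_mesner -> terwilliger x B
| terwilliger_dual B : B \in dual_bose_mesner x -> terwilliger x B
| terwilliger_add B B' :
    terwilliger x B -> terwilliger x B' -> terwilliger x (B + B')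
| terwilliger_scale (c : C) B : terwilliger x B -> terwilliger x (c *: B)
| terwilliger_mul B B' :
    terwilliger x B -> terwilliger x B' -> terwilliger x (B *m B').

Definition terw_module (x : X) (W : {vspace 'cV[C]_#|X|}) : Prop :=
  forall B, terwilliger x B -> forall v, v \in W -> B *m v \in W.

Definition irr_terw_module (x : X) (W : {vspace 'cV[C]_#|X|}) : Prop :=
  [/\ terw_module x W, W != 0%VS
    & forall U : {vspace 'cV[C]_#|X|}, terw_module x U -> (U <= W)%VS ->
        U = 0%VS \/ U = W].

Definition mximg (B : 'M[C]_#|X|) (W : {vspace 'cV[C]_#|X|}) :
    {vspace 'cV[C]_#|X|} := (linfun (mulmx B) @: W)%VS.

(* The default value D of the minimum is irrelevant when W != 0. *)
Definition dual_endpoint (E : 'I_D.+1 -> 'M[C]_#|X|)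
    (W : {vspace 'cV[C]_#|X|}) : nat :=
  \big[minn/D]_(i < D.+1 | mximg (E i) W != 0%VS) (i : nat).

Definition diameter (x : X) (W : {vspace 'cV[C]_#|X|}) : nat :=
  #|[set i : 'I_D.+1 | mximg (dual_idem x i) W != 0%VS]|.-1.

Definition hdot (u v : 'cV[C]_#|X|) : C := \sum_a u a 0 * (v a 0)^*.

Definition orthogonal_decomposition (x : X) (N : nat)
    (W : 'I_N -> {vspace 'cV[C]_#|X|}) : Prop :=
  [/\ forall k, irr_terw_module x (W k),
      forall k l, k != l ->
        forall u v, u \in W k -> v \in W l -> hdot u v = 0,
      directv (\sum_k W k)
    & (\sum_k W k)%VS = fullv].

Definition module_mult (E : 'I_D.+1 -> 'M[C]_#|X|) (x : X) (N : nat)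
    (W : 'I_N -> {vspace 'cV[C]_#|X|}) (t d : nat) : nat :=
  #|[set k | (dual_endpoint E (W k) == t) && (diameter x (W k) == d)]|.

End Algebra.

(* For t and d integers, membership in Upsilon forces both to be
   nonnegative. *)
Definition Upsilon (D t d : nat) : bool :=
  [&& d <= D, D - d <= 2 * t & t <= D - d]%N.

Definition Upsilon_le (t d t' d' : nat) : bool :=
  ((t <= t') && (t' + d' <= t + d))%N.

Section Coefficients.
Variables (C : numClosedFieldType) (D : nat).

Definition cstar (q : 'I_D.+1 -> 'I_D.+1 -> 'I_D.+1 -> C) (i : nat) : C :=
  if i == 0%N then 0 else q (inord i) (inord 1) (inord i.-1).

Definition bstar (q : 'I_D.+1 -> 'I_D.+1 -> 'I_D.+1 -> C) (i : nat) : C :=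
  if (i < D)%N then q (inord i) (inord 1) (inord i.+1) else 0.

Variables theta thetas : 'I_D.+1 -> C.
Let th (i : nat) : C := theta (inord i).
Let ths (i : nat) : C := thetas (inord i).

(* Only meaningful for i <= d. *)
Definition cstar_mod (t d i : nat) : C :=
  let r := (D - d)%N in
  if i == 0%N then 0
  else if (i < d)%N then
    ((th (t + i) ^+ 2 - th t ^+ 2) * (ths r.+2 - ths r.+1)
     + (th t * th t.+1 - th (t + i) * th (t + i).+1) * (ths r.+1 - ths r))
    / ((th (t + i).-1 - th (t + i)) * (th (t + i).-1 - th (t + i).+1))
  else th (t + d) * (ths r.+1 - ths r) / (th (t + d).-1 - th (t + d)).

(* Only meaningful for i <= d. *)
Definition bstar_mod (t d i : nat) : C :=
  let r := (D - d)%N in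
  if (d <= i)%N then 0
  else if i == 0%N then th t * (ths r - ths r.+1) / (th t - th t.+1)
  else
    ((th (t + i) ^+ 2 - th t ^+ 2) * (ths r.+2 - ths r.+1)
     + (th t * th t.+1 - th (t + i) * th (t + i).-1) * (ths r.+1 - ths r))
    / ((th (t + i).+1 - th (t + i)) * (th (t + i).+1 - th (t + i).-1)).

End Coefficients.

(* Main.v *)
(* Put A* = A*(x) and B = E_t A*^d E_(t+d) A*^d; both sides are the trace
   of B.

   Left side: the entries of A*^d come from the d-th Hadamard power of E_1, and
   expanding Hadamard products with the Krein parameters gives
   tr B = m_t b*_t ... b*_(t+d-1) c*_1 ... c*_d.

   Right side: tr B is the sum of the traces of B on the irreducible modules W.
   Let r be the endpoint of W and v in E*_r W an eigenvector of E*_r A^2 E*_r.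
   As the graph is almost bipartite, v, A v and A^2 v - lam v are eigenvectors of
   A*, so for each j the three vectors E_j A* E_k v (|k - j| <= 1) satisfy a
   Vandermonde system with right-hand side in <E_j v>. Hence the E_j v span W, A*
   is tridiagonal on them, and solving the system gives c*_i(t,d), b*_i(t,d).
   Alternating signs along the spheres around x shows that E*_D W <> 0: otherwise
   some theta_i = - theta_j, which the intersection matrix forbids. So r = D - d,
   and r <= 2 t follows by testing a polynomial of degree 2 t in A against |u|^2
   for u in E_t W. *)
Require Import Defs.
From mathcomp Require Import all_boot all_order all_algebra.
From mathcomp Require Import reals complex.
From mathcomp Require Import ring zify.

Set Implicit Arguments.
Unset Strict Implicit.
Unset Printing Implicit Defensive.

Import GRing.Theory Num.Theory.
Local Open Scope ring_scope.

(** * Resolutions of the identity and stable subspaces *)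

(** The shape of B comes from counting paths. Where A* is tridiagonal, E_(t+d) A*^d E_t sees only
    the straight climb from t to t + d, and E_t A*^d E_(t+d) only the straight descent; this yields
    the single product of the b*_h(i,j) c*_(h+1)(i,j). On a module with parameters (i,j) both paths
    exist exactly when (i,j) precedes (t,d), whence the order on Upsilon; otherwise B is 0 there. As
    each E_k W is at most a line, B has rank at most one on W and its trace is one scalar. Two
    obstacles shape the module part. The diameter counts the spheres meeting W, whereas the formulas
    run over the k with E_k W nonzero, so the two counts have to be proved equal. And the eigenvalue
    lam is not known from (t,d): it is eliminated by the equation at the dual endpoint, below which
    W has no component. *)

Definition stable_under (F : fieldType) (n : nat) (B : 'M[F]_n)
    (U : {vspace 'cV[F]_n}) : Prop :=
  forall u, u \in U -> B *m u \in U.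

(* Indexing by nat, with E i = 0 beyond D, spares the boundary cases of
   tridiagonal relations. *)
Definition resolution (F : fieldType) (n D : nat) (E : nat -> 'M[F]_n) : Prop :=
  [/\ forall i j, E i *m E j = if i == j then E i else 0,
      \sum_(i < D.+1) E i = 1%:M
    & forall i, (D < i)%N -> E i = 0].

Section Resolution.
Variables (F : fieldType) (n D : nat) (E : nat -> 'M[F]_n).
Hypothesis resE : resolution D E.

Lemma res_orth i j : E i *m E j = if i == j then E i else 0.
Proof. by case: resE => H _ _; apply: H. Qed.

Lemma res_idem i : E i *m E i = E i.
Proof. by rewrite res_orth eqxx. Qed.

Lemma res_big i : (D < i)%N -> E i = 0.
Proof. by case: resE => _ _; apply. Qed.

Lemma res_sum m (B : 'M[F]_(n, m)) : B = \sum_(i < D.+1) E i *m B.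
Proof. by case: resE => _ H _; rewrite -mulmx_suml H mul1mx. Qed.

Lemma res_insert m p (B : 'M[F]_(p, n)) (B' : 'M[F]_(n, m)) :
  B *m B' = \sum_(i < D.+1) B *m E i *m B'.
Proof.
by rewrite {1}(res_sum B') mulmx_sumr; apply: eq_bigr => i _; rewrite mulmxA.
Qed.

Lemma res_pick m i (f : nat -> 'M[F]_(n, m)) :
  E i *m (\sum_(k < D.+1) E k *m f k) = E i *m f i.
Proof.
rewrite mulmx_sumr; under eq_bigr => k _ do rewrite mulmxA res_orth.
have [iD|iD] := leqP i D; last first.
  by rewrite res_big // mul0mx big1 // => k _; rewrite if_same mul0mx.
have iD' : (i < D.+1)%N by [].
rewrite (bigD1 (Ordinal iD')) //= eqxx big1 ?addr0 // => k.
by rewrite -val_eqE /= eq_sym => /negbTE ->; rewrite mul0mx.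
Qed.

Lemma res_inj (u v : 'cV[F]_n) : (forall i, E i *m u = E i *m v) -> u = v.
Proof.
by move=> H; rewrite (res_sum u) (res_sum v); apply: eq_bigr => i _; rewrite H.
Qed.

Lemma res_neq0 (u : 'cV[F]_n) : u != 0 -> exists2 i, (i <= D)%N & E i *m u != 0.
Proof.
move=> nu; have [/existsP[i Hi]|] := boolP [exists i : 'I_D.+1, E i *m u != 0].
  by exists i => //; rewrite -ltnS ltn_ord.
rewrite negb_exists => /forallP H; case/eqP: nu.
by rewrite (res_sum u) big1 // => i _; move: (H i); rewrite negbK => /eqP.
Qed.

Variables (A : 'M[F]_n) (th : nat -> F).
Hypothesis AE : forall i, A *m E i = th i *: E i.

Lemma res_eigenr i : E i *m A = th i *: E i.
Proof.
have -> : A = \sum_(k < D.+1) E k *m (th k *: 1%:M).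
  rewrite -[LHS]mulmx1 (res_insert A 1%:M).
  by apply: eq_bigr => k _; rewrite AE mulmx1 -scalemxAr mulmx1.
by rewrite (res_pick _ (fun k => th k *: 1%:M)) -scalemxAr mulmx1.
Qed.

Lemma stable_res (U : {vspace 'cV[F]_n}) :
  (forall i, stable_under (E i) U) -> stable_under A U.
Proof.
move=> H u Hu; rewrite -[A]mulmx1 -mulmxA mul1mx (res_insert A u).
by apply: memv_suml => i _; rewrite AE -scalemxAl memvZ // H.
Qed.

Definition head_proj k : 'M[F]_n := \sum_(i < k) E i.

Lemma res_head_proj i k : E i *m head_proj k = if (i < k)%N then E i else 0.
Proof.
rewrite /head_proj mulmx_sumr; under eq_bigr => j _ do rewrite res_orth.
case: ltnP => ik.
  rewrite (bigD1 (Ordinal ik)) //= eqxx big1 ?addr0 // => j.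
  by rewrite -val_eqE /= eq_sym => /negbTE ->.
by rewrite big1 // => j _; rewrite gtn_eqF // (leq_trans (ltn_ord j)).
Qed.

Lemma head_proj_fixP k (u : 'cV[F]_n) :
  reflect (forall i, (k <= i)%N -> E i *m u = 0) (head_proj k *m u == u).
Proof.
apply: (iffP eqP) => [<- i ki|H].
  by rewrite mulmxA res_head_proj ltnNge ki mul0mx.
apply: res_inj => i; rewrite mulmxA res_head_proj; case: ltnP => // ki.
by rewrite mul0mx H.
Qed.

Definition head_part (W : {vspace 'cV[F]_n}) k : {vspace 'cV[F]_n} :=
  (W :&: lker (linfun (mulmx (head_proj k - 1%:M))))%VS.

Lemma mem_head_part (W : {vspace 'cV[F]_n}) k u :
  reflect (u \in W /\ forall i, (k <= i)%N -> E i *m u = 0)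
    (u \in head_part W k).
Proof.
rewrite memv_cap memv_ker lfunE /= mulmxBl mul1mx subr_eq0.
apply: (iffP andP) => -[uW /head_proj_fixP H]; split=> //.
Qed.

Lemma head_part_sub (W : {vspace 'cV[F]_n}) k : (head_part W k <= W)%VS.
Proof. exact: capvSl. Qed.

(* The span of the components of index at most k is a submodule as soon as B
   does not lead out of it. *)
Lemma irreducible_cut (B : 'M[F]_n) (W : {vspace 'cV[F]_n}) k :
  (forall i, stable_under (E i) W) -> stable_under B W ->
  (forall U : {vspace 'cV[F]_n}, (U <= W)%VS ->
     (forall i, stable_under (E i) U) -> stable_under B U ->
     U = 0%VS \/ U = W) ->
  (forall i j w, w \in W -> (i <= k < j)%N -> E j *m B *m E i *m w = 0) ->
  forall i j u w, (i <= k < j)%N -> u \in W -> w \in W -> E i *m u != 0 ->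
    E j *m w = 0.
Proof.
move=> WE WB irr HB i j u w /andP[ik kj] uW wW nu.
have [||U0|UW] := irr (head_part W k.+1) (head_part_sub _ _).
- move=> l z /mem_head_part[zW Hz]; apply/mem_head_part; split; first exact: WE.
  by move=> m km; rewrite mulmxA res_orth; case: eqP => _; rewrite ?mul0mx ?Hz.
- move=> z /mem_head_part[zW Hz]; apply/mem_head_part; split; first exact: WB.
  move=> m km; rewrite mulmxA (res_insert (E m *m B)) big1 // => l _.
  have [lk|kl] := leqP l k; first by rewrite HB // lk.
  by rewrite -mulmxA Hz // mulmx0.
- have : E i *m u \in head_part W k.+1.
    apply/mem_head_part; split; first exact: WE.
    move=> m km; rewrite mulmxA res_orth gtn_eqF ?mul0mx //.
    exact: leq_ltn_trans km.
  by rewrite U0 memv0 (negbTE nu).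
- by move: wW; rewrite -UW => /mem_head_part[_]; apply.
Qed.

End Resolution.

(** * Thin vectors *)

Section ThinAction.
Variables (F : fieldType) (n D : nat).
Variables (A As : 'M[F]_n) (E : nat -> 'M[F]_n) (th : nat -> F).
Hypothesis D_gt0 : (0 < D)%N.
Hypothesis resE : resolution D E.
Hypothesis AE : forall i, A *m E i = th i *: E i.
Hypothesis th_inj : forall i j, (i <= D)%N -> (j <= D)%N -> th i = th j -> i = j.
Hypothesis triAs :
  forall i j, (i.+1 < j)%N || (j.+1 < i)%N -> E i *m As *m E j = 0.
Variables (v : 'cV[F]_n) (lam s0 s1 s2 : F).
Hypothesis As_v : As *m v = s0 *: v.
Hypothesis As_Av : As *m (A *m v) = s1 *: (A *m v).
Hypothesis As_AAv :
  As *m (A *m (A *m v) - lam *: v) = s2 *: (A *m (A *m v) - lam *: v).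

Let EA := res_eigenr resE AE.

Lemma th_neq i j : (i <= D)%N -> (j <= D)%N -> i != j -> th i - th j != 0.
Proof. by move=> iD jD; apply: contraNneq => /subr0_eq /th_inj ->. Qed.

(** Origin of the formula: (A - a)(A - b) v = (A^2 v - lam v) - (a + b) A v + (lam + a b) v combines
    three eigenvectors of [As], and E_j turns powers of A into powers of [th j]. *)
Definition thin_coef (a b : F) j : F :=
  s2 * (th j ^+ 2 - lam) + s0 * lam - (a + b) * s1 * th j + a * b * s0.

(* As acts by a scalar on v, on A v and on A^2 v - lam v, so evaluating
   E j As on a quadratic polynomial in A applied to v gives a multiple of
   E j v; three nodes k contribute, and a, b can be chosen to kill two. *)
Lemma thin_quadratic a b j :
  \sum_(k < D.+1) ((th k - a) * (th k - b)) *: (E j *m As *m E k *m v)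
  = thin_coef a b j *: (E j *m v).
Proof.
have EAv k : E k *m (A *m v) = th k *: (E k *m v).
  by rewrite mulmxA EA scalemxAl.
have EAAv k : E k *m (A *m (A *m v)) = (th k ^+ 2) *: (E k *m v).
  by rewrite mulmxA EA -scalemxAl EAv scalerA expr2.
transitivity (E j *m As *m (A *m (A *m v) - (a + b) *: (A *m v) + (a * b) *: v)).
  rewrite [RHS](res_insert resE); apply: eq_bigr => k _.
  rewrite -(mulmxA (E j *m As)) -[in RHS]mulmxA.
  rewrite mulmxDr mulmxBr -!scalemxAr EAv EAAv scalerA -scalerBl -scalerDl.
  by rewrite scalemxAr; congr (_ *m (_ *: _)); ring.
rewrite -mulmxA.
have -> : A *m (A *m v) - (a + b) *: (A *m v) + (a * b) *: v
        = (A *m (A *m v) - lam *: v) - (a + b) *: (A *m v) + (lam + a * b) *: v.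
  move: (A *m (A *m v)) (A *m v) => P Q.
  by apply/matrixP => p r; rewrite !mxE; ring.
rewrite mulmxDr (mulmxDr As) mulmxN -!scalemxAr As_AAv As_Av As_v.
rewrite mulmxDr mulmxDr mulmxN -!scalemxAr mulmxDr mulmxN -!scalemxAr EAv EAAv.
rewrite -scalerBl !scalerA -scalerBl -scalerDl; congr (_ *: _).
by rewrite /thin_coef; ring.
Qed.

(** Degree one suffices at the two ends of the support, where one neighbour of j carries no part of
    v; neither [lam] nor [s2] enters. *)
Lemma thin_linear a j :
  \sum_(k < D.+1) (th k - a) *: (E j *m As *m E k *m v)
  = (s1 * th j - a * s0) *: (E j *m v).
Proof.
have EAv k : E k *m (A *m v) = th k *: (E k *m v).
  by rewrite mulmxA EA scalemxAl.
transitivity (E j *m As *m (A *m v - a *: v)).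
  rewrite [RHS](res_insert resE); apply: eq_bigr => k _.
  rewrite -(mulmxA (E j *m As)) -[in RHS]mulmxA.
  by rewrite mulmxBr -!scalemxAr EAv -scalerBl scalemxAr.
rewrite -mulmxA mulmxBr -!scalemxAr As_Av As_v mulmxBr -!scalemxAr EAv.
by rewrite !scalerA -scalerBl.
Qed.

Lemma tri_single (f : nat -> F) j k : (k <= D)%N ->
  (forall i, (i <= D)%N -> i != k -> (i <= j.+1)%N -> (j <= i.+1)%N -> f i = 0) ->
  \sum_(i < D.+1) f i *: (E j *m As *m E i *m v)
  = f k *: (E j *m As *m E k *m v).
Proof.
move=> kD H; have kD' : (k < D.+1)%N by [].
rewrite (bigD1 (Ordinal kD')) //= big1 ?addr0 // => i.
rewrite -val_eqE /= => ik.
have [/andP[ij ji]|far] := boolP ((i <= j.+1)%N && (j <= i.+1)%N).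
  by rewrite H ?scale0r // -ltnS.
by rewrite triAs ?mul0mx ?scaler0 //; lia.
Qed.

Lemma thin_solve_quadratic a b j k : (k <= D)%N ->
  (forall i, (i <= D)%N -> i != k -> (i <= j.+1)%N -> (j <= i.+1)%N ->
     (th i - a) * (th i - b) = 0) ->
  (th k - a) * (th k - b) != 0 ->
  E j *m As *m E k *m v
  = (thin_coef a b j / ((th k - a) * (th k - b))) *: (E j *m v).
Proof.
move=> kD H nz; apply: (scalerI nz).
rewrite scalerA mulrCA divff // mulr1 -thin_quadratic.
by rewrite (tri_single (f := fun k => (th k - a) * (th k - b)) kD).
Qed.

Lemma thin_closed j k : exists c, E j *m As *m E k *m v = c *: (E j *m v).
Proof.
have [kD|kD] := leqP k D; last first.
  by exists 0; rewrite (res_big resE kD) mulmx0 mul0mx scale0r.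
have [jD|jD] := leqP j D; last first.
  by exists 0; rewrite (res_big resE jD) !mul0mx scaler0.
have [/triAs->|far] := boolP ((j.+1 < k)%N || (k.+1 < j)%N).
  by exists 0; rewrite mul0mx scale0r.
have [a [b [H nz]]] : exists a b,
    (forall i, (i <= D)%N -> i != k -> (i <= j.+1)%N -> (j <= i.+1)%N ->
       (th i - a) * (th i - b) = 0) /\ (th k - a) * (th k - b) != 0.
  (* The roots sit at the neighbours of j, or j itself, other than k. They may coincide near 0 and
     D; they only have to avoid k and stay at most D, where [th] is injective. *)
  have pick a b : (a <= D)%N -> (b <= D)%N -> a != k -> b != k ->
      (forall i, (i <= D)%N -> i != k -> (i <= j.+1)%N -> (j <= i.+1)%N ->
         (i == a) || (i == b)) ->
      exists a b, (forall i, (i <= D)%N -> i != k -> (i <= j.+1)%N ->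
        (j <= i.+1)%N ->
        (th i - a) * (th i - b) = 0) /\ (th k - a) * (th k - b) != 0.
    move=> aD bD ak bk H; exists (th a), (th b); split.
      move=> i iD ik i1 i2; apply/eqP; rewrite mulf_eq0 !subr_eq0.
      by case/orP: (H i iD ik i1 i2) => /eqP->; rewrite eqxx ?orbT.
    by rewrite mulf_neq0 // th_neq // eq_sym.
  have [kj|[kj|kj]] : (k = j.+1 \/ k = j \/ j = k.+1)%N by lia.
  - by apply: (pick j j.-1); lia.
  - have [j0|j0] := posnP j; first by apply: (pick 1 1)%N; lia.
    have [jD'|jD'] := ltnP j D; first by apply: (pick j.-1 j.+1); lia.
    by apply: (pick j.-1 j.-1); lia.
  - have [jD'|jD'] := ltnP j D; first by apply: (pick j j.+1); lia.
    by apply: (pick j j); lia.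
by eexists; exact: thin_solve_quadratic H nz.
Qed.

Lemma thin_cstar_last j : (0 < j <= D)%N -> E j.+1 *m v = 0 ->
  E j *m As *m E j.-1 *m v
  = (th j * (s1 - s0) / (th j.-1 - th j)) *: (E j *m v).
Proof.
move=> /andP[j0 jD] Ej; have nz : th j.-1 - th j != 0 by apply: th_neq; lia.
have jD' : (j.-1 < D.+1)%N by lia.
apply: (scalerI nz).
have := thin_linear (th j) j.
rewrite (bigD1 (Ordinal jD')) //= big1 ?addr0 => [->|k].
  by rewrite scalerA; congr (_ *: _); field; rewrite nz.
rewrite -val_eqE /= => kj.
have [->|kj'] := eqVneq (k : nat) j; first by rewrite subrr scale0r.
have [->|kj''] := eqVneq (k : nat) j.+1.
  by rewrite -mulmxA Ej mulmx0 scaler0.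
by rewrite triAs ?mul0mx ?scaler0 //; lia.
Qed.

Variable t : nat.
Hypothesis tD : (t <= D)%N.
Hypothesis Etv : E t *m v != 0.
Hypothesis Ebelow : forall i, (i < t)%N -> E i *m v = 0.

(* This fixes the value of (s2 - s0) * lam. *)
Lemma thin_coef_endpoint : (t < D)%N -> thin_coef (th t) (th t.+1) t = 0.
Proof.
move=> tD'; apply/eqP; suff: thin_coef (th t) (th t.+1) t *: (E t *m v) == 0.
  by rewrite scaler_eq0 (negbTE Etv) orbF.
rewrite -thin_quadratic; apply/eqP; apply: big1 => k _.
have [kt|tk] := ltnP k t.
  by rewrite -mulmxA Ebelow // mulmx0 scaler0.
have [->|kt] := eqVneq (k : nat) t; first by rewrite subrr mul0r scale0r.
have [->|kt'] := eqVneq (k : nat) t.+1; first by rewrite subrr mulr0 scale0r.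
by rewrite triAs ?mul0mx ?scaler0 //; lia.
Qed.

Lemma thin_bstar0 : (t < D)%N ->
  E t *m As *m E t.+1 *m v
  = (th t * (s0 - s1) / (th t - th t.+1)) *: (E t *m v).
Proof.
move=> tD'; have nz : th t.+1 - th t != 0 by apply: th_neq => //; lia.
apply: (scalerI nz).
have := thin_linear (th t) t.
rewrite (bigD1 (Ordinal (tD' : t.+1 < D.+1)%N)) //= big1 ?addr0 => [->|k].
  rewrite scalerA; congr (_ *: _).
  by rewrite -(opprB (th t.+1)) invrN; field; rewrite nz.
rewrite -val_eqE /= => kt.
have [kt'|tk] := ltnP k t.
  by rewrite -mulmxA Ebelow // mulmx0 scaler0.
have [->|kt''] := eqVneq (k : nat) t; first by rewrite subrr scale0r.
by rewrite triAs ?mul0mx ?scaler0 //; lia.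
Qed.

(** The roots th j and th j.+1 isolate the node j - 1. Subtracting the coefficient of
    [thin_coef_endpoint], which is zero, cancels (s2 - s0) lam and produces the differences with th
    t in the numerator. *)
Lemma thin_cstar j : (t < j < D)%N ->
  E j *m As *m E j.-1 *m v
  = (((th j ^+ 2 - th t ^+ 2) * (s2 - s1)
      + (th t * th t.+1 - th j * th j.+1) * (s1 - s0))
     / ((th j.-1 - th j) * (th j.-1 - th j.+1))) *: (E j *m v).
Proof.
move=> /andP[tj jD]; have := thin_coef_endpoint (ltn_trans tj jD).
rewrite /thin_coef => H0.
rewrite (thin_solve_quadratic (a := th j) (b := th j.+1)).
- by congr ((_ / _) *: _); rewrite -[LHS]subr0 -H0 /thin_coef; ring.
- by lia.
- move=> i iD ik i1 i2; apply/eqP; rewrite mulf_eq0 !subr_eq0.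
  have /orP[/eqP->|/eqP->] : (i == j) || (i == j.+1) by lia.
    by rewrite eqxx.
  by rewrite eqxx orbT.
by rewrite mulf_neq0 // th_neq //; lia.
Qed.

Lemma thin_bstar j : (t < j < D)%N ->
  E j *m As *m E j.+1 *m v
  = (((th j ^+ 2 - th t ^+ 2) * (s2 - s1)
      + (th t * th t.+1 - th j * th j.-1) * (s1 - s0))
     / ((th j.+1 - th j) * (th j.+1 - th j.-1))) *: (E j *m v).
Proof.
move=> /andP[tj jD]; have := thin_coef_endpoint (ltn_trans tj jD).
rewrite /thin_coef => H0.
rewrite (thin_solve_quadratic (a := th j) (b := th j.-1)).
- by congr ((_ / _) *: _); rewrite -[LHS]subr0 -H0 /thin_coef; ring.
- by lia.
- move=> i iD ik i1 i2; apply/eqP; rewrite mulf_eq0 !subr_eq0.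
  have /orP[/eqP->|/eqP->] : (i == j) || (i == j.-1) by lia.
    by rewrite eqxx.
  by rewrite eqxx orbT.
by rewrite mulf_neq0 // th_neq //; lia.
Qed.

End ThinAction.

(** The product of the B - a, a in l, applied to u. Zero shifts give the powers of B; eigenvalues as
    shifts give annihilating polynomials. *)
Definition shifted_prod (F : fieldType) (n : nat) (B : 'M[F]_n) (l : seq F)
    (u : 'cV[F]_n) : 'cV[F]_n :=
  foldr (fun a w => B *m w - a *: w) u l.

Lemma shifted_prod_cons (F : fieldType) (n : nat) (B : 'M[F]_n) a l u :
  shifted_prod B (a :: l) u = B *m shifted_prod B l u - a *: shifted_prod B l u.
Proof. by []. Qed.

Lemma shifted_prod_stable (F : fieldType) (n : nat) (B : 'M[F]_n) l
    (U : {vspace 'cV[F]_n}) u :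
  stable_under B U -> u \in U -> shifted_prod B l u \in U.
Proof.
by move=> BU uU; elim: l => //= a l IH; rewrite memvB ?memvZ // BU.
Qed.

Lemma shifted_prod_eigen (F : fieldType) (n : nat) (B : 'M[F]_n) l a u :
  B *m u = a *: u -> shifted_prod B l u = (\prod_(b <- l) (a - b)) *: u.
Proof.
move=> Bu; elim: l => [|b l IH] /=; first by rewrite big_nil scale1r.
by rewrite IH -scalemxAr Bu big_cons !scalerA -scalerBl mulrBl [_ * a]mulrC.
Qed.

Lemma shifted_prodD (F : fieldType) (n : nat) (B : 'M[F]_n) l u w :
  shifted_prod B l (u + w) = shifted_prod B l u + shifted_prod B l w.
Proof.
elim: l => //= a l ->; rewrite mulmxDr scalerDr opprD.
by rewrite addrACA.
Qed.

Lemma shifted_prod0 (F : fieldType) (n : nat) (B : 'M[F]_n) l :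
  shifted_prod B l 0 = 0.
Proof. by elim: l => //= a l ->; rewrite mulmx0 scaler0 subr0. Qed.

(** * Straight paths of a tridiagonal operator *)

Section TridiagonalPaths.
Variables (F : fieldType) (n D : nat).
Variables (As : 'M[F]_n) (E : nat -> 'M[F]_n).
Hypothesis resE : resolution D E.
Hypothesis triAs :
  forall i j, (i.+1 < j)%N || (j.+1 < i)%N -> E i *m As *m E j = 0.
Variable v : 'cV[F]_n.

Lemma shifted_prod_above l s j : (s + size l < j)%N ->
  E j *m shifted_prod As l (E s *m v) = 0.
Proof.
elim: l j => [|a l IH] j /=.
  by rewrite addn0 mulmxA (res_orth resE) => /gtn_eqF->; rewrite mul0mx.
rewrite addnS => sj; rewrite mulmxBr -scalemxAr IH ?scaler0 ?subr0 //; last lia.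
rewrite mulmxA [LHS](res_insert resE) big1 // => k _.
have [kl|lk] := leqP k (s + size l)%N; last by rewrite -mulmxA IH // mulmx0.
by rewrite triAs ?mul0mx //; lia.
Qed.

Lemma shifted_prod_top_step a l s :
  E (s + (size l).+1) *m shifted_prod As (a :: l) (E s *m v)
  = E (s + size l).+1 *m As *m (E (s + size l) *m shifted_prod As l (E s *m v)).
Proof.
rewrite addnS shifted_prod_cons mulmxBr -scalemxAr.
rewrite (@shifted_prod_above _ _ (s + size l).+1) // scaler0 subr0.
rewrite !mulmxA [LHS](res_insert resE).
have [lD|Dl] := leqP (s + size l) D; last first.
  rewrite (res_big resE Dl) mulmx0 mul0mx big1 // => k _.
  by rewrite (@res_big _ _ _ _ resE (s + size l).+1) ?mul0mx //; lia.
have lD' : (s + size l < D.+1)%N by [].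
rewrite (bigD1 (Ordinal lD')) //= big1 ?addr0 // => k.
rewrite -val_eqE /= => kl.
have [kl'|lk] := leqP k (s + size l)%N; last first.
  by rewrite -mulmxA shifted_prod_above // mulmx0.
by rewrite triAs ?mul0mx //; lia.
Qed.

(** There are as many factors as steps, so every factor must climb by one; the shifts keep the index
    and drop out. *)
Lemma shifted_prod_top (c : nat -> F) l s :
  (forall k, (s <= k < s + size l)%N ->
     E k.+1 *m As *m E k *m v = c k *: (E k.+1 *m v)) ->
  E (s + size l) *m shifted_prod As l (E s *m v)
  = (\prod_(s <= k < s + size l) c k) *: (E (s + size l) *m v).
Proof.
elim: l => [|a l IH] Hc.
  by rewrite /= addn0 big_geq // scale1r mulmxA (res_idem resE).
rewrite [size _]/= shifted_prod_top_step IH => [|k kl]; last by apply: Hc => /=; lia.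
rewrite -scalemxAr mulmxA Hc /=; last lia.
by rewrite addnS big_nat_recr ?leq_addr //= scalerA.
Qed.

Lemma iter_below m s j : (j + m < s)%N -> E j *m iter m (mulmx As) (E s *m v) = 0.
Proof.
elim: m j => [|m IH] j /=.
  by rewrite addn0 mulmxA (res_orth resE) => /ltn_eqF->; rewrite mul0mx.
rewrite addnS => sj; rewrite mulmxA [LHS](res_insert resE) big1 // => k _.
have [kl|lk] := ltnP (k + m)%N s; first by rewrite -mulmxA IH // mulmx0.
by rewrite triAs ?mul0mx //; lia.
Qed.

Lemma iter_bottom (b : nat -> F) m s :
  (forall k, (s <= k < s + m)%N ->
     E k *m As *m E k.+1 *m v = b k *: (E k *m v)) ->
  E s *m iter m (mulmx As) (E (s + m) *m v)
  = (\prod_(s <= k < s + m) b k) *: (E s *m v).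
Proof.
elim: m s => [|m IH] s Hb.
  by rewrite /= addn0 big_geq // scale1r mulmxA (res_idem resE).
rewrite /= mulmxA [LHS](res_insert resE).
(* For s at least D both sides vanish: [E (s + m.+1)] is 0, and the factor [b s] kills [E s *m v]
   because [E s.+1] is 0. *)
have [sD|Ds] := ltnP s D; last first.
  have Esm : E (s + m.+1) = 0 by rewrite (res_big resE) //; lia.
  have it0 : iter m (mulmx As) 0 = 0 :> 'cV[F]_n.
    by elim: (m) => //= k ->; rewrite mulmx0.
  rewrite Esm mul0mx it0.
  have Hs : b s *: (E s *m v) = 0.
    rewrite -Hb; last lia.
    by rewrite (@res_big _ _ _ _ resE s.+1) // mulmx0 mul0mx.
  rewrite big1 => [|k _]; last by rewrite mulmx0.
  rewrite big_ltn; last lia.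
  by rewrite mulrC -scalerA Hs scaler0.
have sD' : (s.+1 < D.+1)%N by [].
rewrite (bigD1 (Ordinal sD')) //= big1 ?addr0 => [|k].
  rewrite -mulmxA addnS -addSn IH => [|k ks]; last by apply: Hb; lia.
  rewrite -scalemxAr mulmxA Hb; last lia.
  rewrite scalerA [in RHS]big_ltn; last by rewrite addSn ltnS leq_addr.
  by rewrite mulrC.
rewrite -val_eqE /= => ks.
have [ks'|sk] := leqP k s; last by rewrite triAs ?mul0mx //; lia.
by rewrite -mulmxA iter_below ?mulmx0 //; lia.
Qed.

End TridiagonalPaths.

(** * Irreducible modules spanned by the components of one vector *)

Section ThinModule.
Variables (F : fieldType) (n D : nat).
Variables (As : 'M[F]_n) (E : nat -> 'M[F]_n).
Hypothesis resE : resolution D E.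
Hypothesis triAs :
  forall i j, (i.+1 < j)%N || (j.+1 < i)%N -> E i *m As *m E j = 0.
Variables (W : {vspace 'cV[F]_n}) (v : 'cV[F]_n).
Hypothesis thinv : forall j k, exists c, E j *m As *m E k *m v = c *: (E j *m v).
Hypothesis EW : forall i, stable_under (E i) W.
Hypothesis AsW : stable_under As W.
Hypothesis irrW : forall U : {vspace 'cV[F]_n}, (U <= W)%VS ->
  (forall i, stable_under (E i) U) -> stable_under As U -> U = 0%VS \/ U = W.
Hypothesis vW : v \in W.
Hypothesis v_neq0 : v != 0.

(** The span of the E_i v is stable under every E_i and, by [thinv], under [As]; it is not 0, so
    irreducibility makes it equal to W. *)
Lemma thin_span : (W <= \sum_(i < D.+1) <[E i *m v]>)%VS.
Proof.
pose U := (\sum_(i < D.+1) <[E i *m v]>)%VS.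
have EvU i : E i *m v \in U.
  have [iD|/(res_big resE)->] := leqP i D; last by rewrite mul0mx mem0v.
  have iD' : (i < D.+1)%N by [].
  by apply/(subvP (sumv_sup (Ordinal iD') _ (subvv _))) => //; apply: memv_line.
have [|||U0|<- //] := irrW (U := U).
- by apply/subv_sumP => i _; rewrite -memvE EW.
- move=> i _ /memv_sumP[us Hus ->]; rewrite mulmx_sumr; apply: memv_suml => k _.
  have /vlineP[c ->] := Hus k isT; rewrite -scalemxAr memvZ // mulmxA.
  by rewrite (res_orth resE); case: eqP => _; rewrite ?mul0mx ?mem0v.
- move=> _ /memv_sumP[us Hus ->]; rewrite mulmx_sumr; apply: memv_suml => k _.
  have /vlineP[c ->] := Hus k isT; rewrite -scalemxAr memvZ //.
  rewrite (res_sum resE (As *m _)); apply: memv_suml => j _.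
  by have [c' H] := thinv j k; rewrite !mulmxA H memvZ.
- case/eqP: v_neq0; apply: (res_inj resE) => i; apply/eqP.
  by rewrite mulmx0 -memv0 -U0.
Qed.

Lemma thin_component w i : w \in W -> exists c, E i *m w = c *: (E i *m v).
Proof.
move=> /(subvP thin_span) /memv_sumP[us Hus ->].
have [iD|/(res_big resE)->] := leqP i D; last by exists 0; rewrite !mul0mx scaler0.
have iD' : (i < D.+1)%N by [].
have /vlineP[c Hc] := Hus (Ordinal iD') isT; exists c.
rewrite mulmx_sumr (bigD1 (Ordinal iD')) //= Hc -scalemxAr mulmxA.
rewrite (res_idem resE) big1 ?addr0 // => k; rewrite -val_eqE /= eq_sym => ik.
have /vlineP[c' ->] := Hus k isT.
by rewrite -scalemxAr mulmxA (res_orth resE) (negbTE ik) mul0mx scaler0.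
Qed.

(** A step from k to k + 1 that is zero on v is zero on W, each E_k w being a multiple of E_k v; the
    components up to k would then form a proper nonzero submodule. *)
Lemma thin_up_neq0 i k j : (i <= k < j)%N -> E i *m v != 0 -> E j *m v != 0 ->
  E k.+1 *m As *m E k *m v != 0.
Proof.
move=> ikj nEi; apply: contraNneq => H0.
apply/eqP; apply: (irreducible_cut resE EW AsW irrW _ ikj vW vW nEi) => a b w wW /andP[ak kb].
have [/triAs->|near] := boolP ((b.+1 < a)%N || (a.+1 < b)%N).
  by rewrite mul0mx.
have [-> ->] : a = k /\ b = k.+1 by lia.
have [c Hc] := thin_component k wW.
by rewrite -mulmxA Hc -scalemxAr mulmxA H0 scaler0.
Qed.

(** No gap occurs between the least and the greatest index: the step into i is nonzero, and its
    value is a multiple of E_i v. *)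
Lemma thin_support : exists t dd, (t + dd <= D)%N /\
  forall i, (E i *m v != 0) = (t <= i <= t + dd)%N.
Proof.
have exP : exists i, E i *m v != 0.
  by have [i _ H] := res_neq0 resE v_neq0; exists i.
have ubP i : E i *m v != 0 -> (i <= D)%N.
  by apply: contraR; rewrite -ltnNge => /(res_big resE)->; rewrite mul0mx.
case: (ex_minnP exP) => t nt mint; case: (ex_maxnP exP ubP) => u nu maxu.
exists t, (u - t)%N; have tu := mint _ nu; rewrite subnKC //.
split=> [|i]; first exact: ubP.
apply/idP/idP => [ni|/andP[ti iu]]; first by rewrite mint ?maxu.
move: ti; rewrite leq_eqVlt => /orP[/eqP<- //|ti].
have tiu : (t <= i.-1 < u)%N by lia.
have := thin_up_neq0 tiu nt nu; rewrite prednK ?(leq_trans _ ti) //; apply: contraNneq => Ei0.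
by have [c ->] := thinv i i.-1; rewrite Ei0 scaler0.
Qed.

Variables (t dd : nat).
Hypothesis supp : forall i, (E i *m v != 0) = (t <= i <= t + dd)%N.

Lemma thin_vanish i w : w \in W -> ~~ (t <= i <= t + dd)%N -> E i *m w = 0.
Proof.
move=> wW; rewrite -supp negbK => /eqP H0.
by have [c ->] := thin_component i wW; rewrite H0 scaler0.
Qed.

(** Each factor reaches one index further with a nonzero leading term, so no product of at most dd
    linear factors in [As] vanishes on W. This bounds dd from above. *)
Lemma shifted_prod_neq0 l : (size l <= dd)%N ->
  E (t + size l) *m shifted_prod As l (E t *m v) != 0.
Proof.
elim: l => [|a l IH] lD.
  rewrite addn0 /= mulmxA (res_idem resE).
  by have := supp t; rewrite leqnn leq_addr.
have /IH nz : (size l <= dd)%N by apply: ltnW.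
have Etv : E t *m v != 0 by rewrite supp leqnn leq_addr.
have Eend : E (t + dd) *m v != 0 by rewrite supp leqnn leq_addr.
rewrite [size _]/= (shifted_prod_top_step resE triAs).
have uW : shifted_prod As l (E t *m v) \in W by apply: shifted_prod_stable; rewrite ?EW.
have [c Hc] := thin_component (t + size l) uW.
move: nz; rewrite Hc scaler_eq0 negb_or => /andP[nc _].
rewrite -scalemxAr scaler_eq0 negb_or nc /= mulmxA.
apply: (@thin_up_neq0 t _ (t + dd)) => //.
by rewrite leq_addr ltn_add2l.
Qed.

End ThinModule.

Lemma shifted_prod_horner (F : fieldType) (n : nat) (B : 'M[F]_n.+1) l
    (u : 'cV[F]_n.+1) :
  horner_mx B (\prod_(a <- l) ('X - a%:P)) *m u = shifted_prod B l u.
Proof.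
elim: l => [|a l IH]; first by rewrite big_nil rmorph1 mul1mx.
rewrite shifted_prod_cons big_cons rmorphM rmorphB /= horner_mx_X horner_mx_C.
by rewrite -mulmxE -mulmxA IH mulmxBl mul_scalar_mx.
Qed.

(** By Cayley-Hamilton the shifted product over the characteristic roots kills any u in U; its last
    nonzero partial product stays in U and is an eigenvector. *)
Lemma stable_eigenvector (C : numClosedFieldType) (n : nat) (B : 'M[C]_n)
    (U : {vspace 'cV[C]_n}) :
  stable_under B U -> U != 0%VS ->
  exists v a, [/\ v \in U, v != 0 & B *m v = a *: v].
Proof.
case: n B U => [|n] B U BU U0.
  case/eqP: U0; apply/vspaceP => u; rewrite memv0.
  have -> : u = 0 by apply/matrixP => -[].
  by rewrite mem0v eqxx.
have [l Hl] := closed_field_poly_normal (char_poly B).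
have kill u : shifted_prod B l u = 0.
  have := Cayley_Hamilton B; rewrite Hl (monicP (char_poly_monic B)) scale1r.
  by rewrite -shifted_prod_horner => ->; rewrite mul0mx.
have uU := memv_pick U; have nu : vpick U != 0 by rewrite vpick0.
have := kill (vpick U); move: (vpick U) uU nu => u uU nu {kill Hl}.
elim: l => [|a l IH]; first by move=> u0; rewrite [u]u0 eqxx in nu.
have wU := shifted_prod_stable l BU uU.
rewrite shifted_prod_cons => /subr0_eq Ba.
have [/IH //|nw] := eqVneq (shifted_prod B l u) 0.
by exists (shifted_prod B l u), a.
Qed.

Lemma limg_mulmx_neq0P (F : fieldType) (m n : nat) (B : 'M[F]_(m, n))
    (W : {vspace 'cV[F]_n}) :
  reflect (exists2 w, w \in W & B *m w != 0)
    ((linfun (mulmx B) @: W)%VS != 0%VS).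
Proof.
apply: (iffP idP) => [nz|[w wW]].
  have /memv_imgP[w wW Hw] := memv_pick (linfun (mulmx B) @: W).
  exists w => //; move: Hw; rewrite lfunE /= => <-.
  by rewrite vpick0.
apply: contraNneq => H0; rewrite -memv0 -H0.
by apply/memv_imgP; exists w => //; rewrite lfunE.
Qed.

(** * Endpoint, diameter and coefficients of an irreducible module *)

Section ModuleStructure.
Variables (C : numClosedFieldType) (n D : nat).
Variables (A As : 'M[C]_n) (E Es : nat -> 'M[C]_n).
Variables theta thetas : 'I_D.+1 -> C.
Let th i := theta (inord i).
Let ths i := thetas (inord i).
Hypothesis D_gt0 : (0 < D)%N.
Hypothesis resE : resolution D E.
Hypothesis resEs : resolution D Es.
Hypothesis AE : forall i, A *m E i = th i *: E i.
Hypothesis AsEs : forall i, As *m Es i = ths i *: Es i.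
Hypothesis th_inj : forall i j, (i <= D)%N -> (j <= D)%N -> th i = th j -> i = j.
Hypothesis triAs :
  forall i j, (i.+1 < j)%N || (j.+1 < i)%N -> E i *m As *m E j = 0.
Hypothesis triA :
  forall i j, (i.+1 < j)%N || (j.+1 < i)%N -> Es i *m A *m Es j = 0.
Hypothesis flatA : forall i, (i < D)%N -> Es i *m A *m Es i = 0.
Variable W : {vspace 'cV[C]_n}.
Hypothesis EW : forall i, stable_under (E i) W.
Hypothesis EsW : forall i, stable_under (Es i) W.
Hypothesis irrW : forall U : {vspace 'cV[C]_n}, (U <= W)%VS ->
  stable_under A U -> stable_under As U -> U = 0%VS \/ U = W.
Hypothesis EsDW : exists2 w, w \in W & Es D *m w != 0.

Let AW : stable_under A W := stable_res resE AE EW.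
Let AsW : stable_under As W := stable_res resEs AsEs EsW.

(** This is [irreducible_cut] with the two families exchanged: since A moves by at most one sphere,
    a missing sphere between r and D would cut off the components below it. *)
Lemma endpoint_support : exists2 r, (r <= D)%N &
  forall i, (exists2 w, w \in W & Es i *m w != 0) <-> (r <= i <= D)%N.
Proof.
pose P i := (linfun (mulmx (Es i)) @: W)%VS != 0%VS.
have exP : exists i, P i by exists D; apply/limg_mulmx_neq0P.
case: (ex_minnP exP) => r /limg_mulmx_neq0P[u uW nu] minr.
have le_D i : (exists2 w, w \in W & Es i *m w != 0) -> (i <= D)%N.
  move=> [w _]; apply: contraR; rewrite -ltnNge => /(res_big resEs)->.
  by rewrite mul0mx.
have rD : (r <= D)%N by apply: le_D; exists u.
exists r => // i; split=> [wP|].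
  by apply/andP; split; [apply: minr; apply/limg_mulmx_neq0P | apply: le_D].
move=> /andP[]; rewrite leq_eqVlt => /orP[/eqP<- _|ri iD]; first by exists u.
apply/limg_mulmx_neq0P; apply: contraT; rewrite negbK => /eqP Pi.
have Esi w : w \in W -> Es i *m w = 0.
  move=> wW; apply/eqP; rewrite -memv0 -Pi.
  by apply/memv_imgP; exists w => //; rewrite lfunE.
have [w wW] := EsDW; case/eqP.
move: iD; rewrite leq_eqVlt => /orP[/eqP<-|iD]; first exact: Esi.
have irrEs (U : {vspace 'cV[C]_n}) : (U <= W)%VS ->
    (forall i, stable_under (Es i) U) -> stable_under A U -> U = 0%VS \/ U = W.
  by move=> UW UEs UA; apply: irrW => //; exact: (stable_res resEs AsEs UEs).
apply: (irreducible_cut resEs EsW AW irrEs _ (_ : r <= i < D)%N uW wW nu).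
  move=> a b z zW /andP[ai ib].
  have [/triA->|near] := boolP ((b.+1 < a)%N || (a.+1 < b)%N); first by rewrite mul0mx.
  have -> : a = i by lia.
  by rewrite -mulmxA Esi // mulmx0.
by rewrite ltnW.
Qed.

Variable r : nat.
Hypothesis rD : (r <= D)%N.
Hypothesis suppEs :
  forall i, (exists2 w, w \in W & Es i *m w != 0) <-> (r <= i <= D)%N.

Lemma below_endpoint i (w : 'cV[C]_n) : w \in W -> (i < r)%N -> Es i *m w = 0.
Proof.
move=> wW ir; apply/eqP; apply: contraT => nz.
have /suppEs : exists2 w, w \in W & Es i *m w != 0 by exists w.
by rewrite leqNgt ir.
Qed.

Lemma dual_component i (w : 'cV[C]_n) : (forall j, j != i -> Es j *m w = 0) -> Es i *m w = w.
Proof.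
move=> H; apply: (res_inj resEs) => j; rewrite mulmxA (res_orth resEs).
by have [->|/H->] := eqVneq j i; rewrite ?mul0mx.
Qed.

Lemma As_eigen i (w : 'cV[C]_n) : Es i *m w = w -> As *m w = ths i *: w.
Proof. by move=> <-; rewrite mulmxA AsEs -scalemxAl. Qed.

(* For r < D, v is an eigenvector of the lowering-raising map
   Es r A Es (r + 1) A Es r on Es r W. *)
Lemma endpoint_vector : exists v lam, [/\ v \in W, v != 0, As *m v = ths r *: v,
  As *m (A *m v) = ths (minn r.+1 D) *: (A *m v)
  & As *m (A *m (A *m v) - lam *: v)
    = ths (minn r.+2 D) *: (A *m (A *m v) - lam *: v)].
Proof.
(* If r = D, then W lies on the sphere D, [As] is a scalar on it, and lam = 0 serves; [minn] lets
   the statement cover this case. *)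
move: rD; rewrite leq_eqVlt => /orP[/eqP rD'|rD'].
  have [w wW nw] := EsDW.
  have AsW' u : u \in W -> As *m u = ths D *: u.
    move=> uW; apply: As_eigen; apply: dual_component => j jD.
    have [jD'|jD'] := ltnP j D; first by rewrite below_endpoint // rD'.
    by rewrite (res_big resEs) ?mul0mx // ltn_neqAle eq_sym jD.
  have -> : minn r.+1 D = D by lia.
  have -> : minn r.+2 D = D by lia.
  exists w, 0; rewrite rD' scale0r subr0; split=> //; try by apply: AsW'; rewrite ?AW.
  by apply: contraNneq nw => ->; rewrite mulmx0.
have rr1 : (r <= r.+1 <= D)%N by rewrite leqnSn.
pose U := (linfun (mulmx (Es r)) @: W)%VS.
have UP u : u \in U -> u \in W /\ Es r *m u = u.
  move=> /memv_imgP[w wW ->]; rewrite lfunE /=; split; first exact: EsW.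
  by rewrite mulmxA (res_idem resEs).
have [||v [lam [vU nv Hv]]] := @stable_eigenvector _ _ (Es r *m A *m A) U.
- move=> u /UP[uW _]; apply/memv_imgP; exists (A *m (A *m u)).
    by rewrite !AW.
  by rewrite lfunE /= !mulmxA.
- by apply/limg_mulmx_neq0P; apply/suppEs; rewrite leqnn.
have [vW Ev] := UP _ vU.
have EsAv : Es r.+1 *m (A *m v) = A *m v.
  apply: dual_component => j jr; rewrite -Ev !mulmxA.
  have [->|jr'] := eqVneq j r; first by rewrite flatA ?mul0mx.
  have [jr''|jr''] := ltnP j r.
    by rewrite -!mulmxA below_endpoint // AW ?EsW.
  by rewrite triA ?mul0mx //; lia.
exists v, lam; split=> //.
- exact: As_eigen.
- by rewrite (minn_idPl rD'); apply: As_eigen.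
(* The vector lies on the single sphere [minn r.+2 D]: lam removes its part on sphere r, and sphere
   r + 1 receives nothing when r + 1 < D, having no inner edges. When r + 1 = D it is itself the
   target. *)
apply: As_eigen; apply: dual_component => j jr.
rewrite mulmxBr -scalemxAr.
have [->|jr'] := eqVneq j r.
  by rewrite Ev !mulmxA Hv subrr.
have [jlt|jge] := ltnP j r.
  by rewrite !below_endpoint ?AW ?scaler0 ?subr0.
have -> : Es j *m v = 0.
  by rewrite -Ev mulmxA (res_orth resEs) (negbTE jr') mul0mx.
rewrite scaler0 subr0 -EsAv !mulmxA.
have [jr1|jr1] := eqVneq j r.+1.
  by rewrite jr1 flatA ?mul0mx //; lia.
have [jD|jD] := leqP j D; last by rewrite (res_big resEs jD) !mul0mx.
by rewrite triA ?mul0mx //; lia.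
Qed.

(* t and dd are the dual endpoint and the diameter of W. *)
Definition thin_data (t dd : nat) (v : 'cV[C]_n) : Prop :=
  [/\ (t + dd <= D)%N, v \in W,
      forall i, (E i *m v != 0) = (t <= i <= t + dd)%N,
      forall i w, w \in W -> exists c, E i *m w = c *: (E i *m v)
    & forall k, (t <= k < t + dd)%N ->
       E k.+1 *m As *m E k *m v
         = cstar_mod theta thetas t dd (k - t).+1 *: (E k.+1 *m v) /\
       E k *m As *m E k.+1 *m v
         = bstar_mod theta thetas t dd (k - t) *: (E k *m v)].

(** The equality r + dd = D is what turns the eigenvalues of [As] on v, A v and A^2 v - lam v into
    the [ths] at D - dd, D - dd + 1 and D - dd + 2 of the formulas. *)
Lemma thin_structure : exists t dd v, (r + dd = D)%N /\ thin_data t dd v.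
Proof.
have [v [lam [vW nv H0 H1 H2]]] := endpoint_vector.
have irrE (U : {vspace 'cV[C]_n}) : (U <= W)%VS ->
    (forall i, stable_under (E i) U) -> stable_under As U -> U = 0%VS \/ U = W.
  by move=> UW UE UAs; apply: irrW => //; exact: (stable_res resE AE UE).
have thin := thin_closed D_gt0 resE AE th_inj triAs H0 H1 H2.
have comp := thin_component resE thin EW irrE vW nv.
have [t [dd [tdD supp]]] := thin_support resE triAs thin EW AsW irrE vW nv.
have rdd : (r + dd = D)%N.
  apply/eqP; rewrite eqn_leq; apply/andP; split.
    (* As is annihilated on W by a polynomial of degree D - r + 1. *)
    rewrite leqNgt; apply/negP => lt_D.
    pose l := [seq ths i | i <- iota r (D - r).+1].
    have szl : (size l <= dd)%N by rewrite size_map size_iota; lia.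
    have /eqP[] := shifted_prod_neq0 resE triAs thin EW AsW irrE vW nv supp szl.
    suff kill w : w \in W -> shifted_prod As l w = 0 by rewrite kill ?mulmx0 ?EW.
    move=> wW; rewrite (res_sum resEs w).
    elim/big_rec: _ => [|i u _ IH]; first by rewrite shifted_prod0.
    rewrite shifted_prodD IH addr0.
    have [ir|ri] := ltnP i r; first by rewrite below_endpoint // shifted_prod0.
    rewrite (@shifted_prod_eigen _ _ _ _ (ths i)); last first.
      by rewrite mulmxA AsEs -scalemxAl.
    rewrite (big_rem (ths i)) /=; last first.
      apply/map_f; rewrite mem_iota; have := ltn_ord i; lia.
    by rewrite subrr mul0r scale0r.
  (* Conversely, W has dimension at most dd + 1 and contains D - r + 1 independent nonzero spaces,
     its images under the [Es i] with r <= i <= D. *)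
  have dimW : (\dim W <= dd.+1)%N.
    have WS : (W <= \sum_(i < dd.+1) <[E (t + i)%N *m v]>)%VS.
      apply/subvP => w wW; rewrite (res_sum resE w); apply: memv_suml => i _.
      have [ti|ti] := boolP (t <= i <= t + dd)%N; last first.
        by rewrite (thin_vanish resE thin EW irrE vW nv supp wW ti) mem0v.
      have [c ->] := comp w i wW; apply: memvZ.
      have idd : (i - t < dd.+1)%N by lia.
      apply/(subvP (sumv_sup (Ordinal idd) _ (subvv _))) => //=.
      by rewrite subnKC ?memv_line //; case/andP: ti.
    apply: (leq_trans (dimvS WS)); apply: (leq_trans (dimv_leq_sum _ _ _)).
    rewrite -[X in (_ <= X)%N]card_ord -sum1_card; apply: leq_sum => i _.
    by rewrite dim_vline; case: (_ != 0).
  pose U (i : 'I_D.+1) := (linfun (mulmx (Es i)) @: W)%VS.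
  have dirU : directv (\sum_(i < D.+1 | (r <= i)%N) U i).
    apply/directv_sum_independent => us Hus s0 i ri.
    have Hu (j : 'I_D.+1) : (r <= j)%N -> Es j *m us j = us j.
      move=> /Hus /memv_imgP[w _ ->].
      by rewrite lfunE /= mulmxA (res_idem resEs).
    rewrite -Hu // -[RHS](mulmx0 _ (Es i)) -s0 mulmx_sumr (bigD1 i) //=.
    rewrite big1 ?addr0 // => j /andP[rj ji].
    rewrite -(Hu j rj) mulmxA (res_orth resEs) eq_sym.
    by rewrite (inj_eq val_inj) (negbTE ji) mul0mx.
  have : (\dim (\sum_(i < D.+1 | (r <= i)%N) U i)%VS <= \dim W)%N.
    apply: dimvS; apply/subv_sumP => i _; apply/subvP => _ /memv_imgP[w wW ->].
    by rewrite lfunE EsW.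
  move/directvP: dirU => /= ->.
  have : (\sum_(i < D.+1 | (r <= i)%N) 1 <= \sum_(i < D.+1 | (r <= i)%N) \dim (U i))%N.
    apply: leq_sum => i ri; rewrite lt0n dimv_eq0.
    by apply/limg_mulmx_neq0P; apply/suppEs; rewrite ri -ltnS ltn_ord.
  have -> : (\sum_(i < D.+1 | (r <= i)%N) 1 = D.+1 - r)%N.
    rewrite -(big_geq_mkord r D.+1 xpredT (fun=> 1%N)).
    by rewrite sum_nat_const_nat muln1.
  move=> card_le dim_le; have := leq_trans card_le (leq_trans dim_le dimW); lia.
exists t, dd, v; split=> //; split=> // [i w|k /andP[tk kd]]; first exact: comp.
have Etv : E t *m v != 0 by rewrite supp leqnn leq_addr.
have Ebelow i : (i < t)%N -> E i *m v = 0.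
  by move=> it; apply/eqP; rewrite -[_ == _]negbK supp leqNgt it.
have Dr : (D - dd = r)%N by lia.
split.
  rewrite /cstar_mod /= Dr.
  case: ltnP => kdd.
    (* An interior index forces dd > 1, hence r + 2 <= D, and both minima are their first
       arguments. *)
    have tkD : (t < k.+1 < D)%N by lia.
    rewrite (thin_cstar D_gt0 resE AE th_inj triAs H0 H1 H2 (ltnW _) Etv Ebelow tkD) //; last lia.
    have -> : minn r.+1 D = r.+1 by lia.
    have -> : minn r.+2 D = r.+2 by lia.
    by have -> : (t + (k - t).+1 = k.+1)%N by lia.
  have Ek : E k.+2 *m v = 0 by apply/eqP; rewrite -[_ == _]negbK supp; lia.
  rewrite (thin_cstar_last D_gt0 resE AE th_inj triAs H0 H1 _ Ek) //; last lia.
  have -> : minn r.+1 D = r.+1 by lia.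
  by have -> : (t + dd = k.+1)%N by lia.
rewrite /bstar_mod Dr leqNgt.
have -> /= : (k - t < dd)%N by lia.
case: eqP => kt.
  have -> : k = t by lia.
  rewrite (thin_bstar0 D_gt0 resE AE th_inj triAs H0 H1 _ Etv Ebelow); try lia.
  by have -> : minn r.+1 D = r.+1 by lia.
have tkD : (t < k < D)%N by lia.
rewrite (thin_bstar D_gt0 resE AE th_inj triAs H0 H1 H2 (ltnW _) Etv Ebelow tkD) //; last lia.
have -> : minn r.+1 D = r.+1 by lia.
have -> : minn r.+2 D = r.+2 by lia.
by have -> : (t + (k - t) = k)%N by lia.
Qed.

End ModuleStructure.

(** * The Bose-Mesner algebra *)

Lemma mem_span_image (F : fieldType) (V : vectType F) (I : finType) (f : I -> V) v :
  v \in <<[seq f i | i : I]>>%VS -> exists b : I -> F, v = \sum_i b i *: f i.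
Proof.
rewrite span_def big_image /= => /memv_sumP[vs Hvs ->].
have /fin_all_exists[b Hb] : forall i, exists b, vs i = b *: f i.
  by move=> i; apply/vlineP; apply: Hvs.
by exists b; apply: eq_bigr => i _.
Qed.

(** The nonzero leading coefficient expresses G at i + 1 through op applied to G at i and the
    earlier terms. It serves twice: for the A_i as polynomials in A, and for their duals in A*. *)
Lemma three_term_ind (F : fieldType) (V : lmodType F) (D : nat) (P : V -> Prop)
    (G : 'I_D.+1 -> V) (op : V -> V) (p : 'I_D.+1 -> 'I_D.+1 -> F) :
  (forall i, op (G i) = \sum_h p h i *: G h) ->
  (forall h i : 'I_D.+1, (i.+1 < h)%N -> p h i = 0) ->
  (forall h i : 'I_D.+1, h = i.+1 :> nat -> p h i != 0) ->
  (forall u v, P u -> P v -> P (u + v)) -> (forall a u, P u -> P (a *: u)) ->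
  (forall u, P u -> P (op u)) -> P (G ord0) -> forall i, P (G i).
Proof.
move=> opG p0 p1 PD PZ Pop P0 i.
have [k] := ubnP (i : nat); elim: k i => // k IH i; rewrite ltnS => ik.
have [i0|i0] := posnP i; first by rewrite (_ : i = ord0) //; apply: val_inj.
have jD : (i.-1 < D.+1)%N by rewrite (leq_ltn_trans (leq_pred i)).
pose j := Ordinal jD; have ij : i = j.+1 :> nat by rewrite /= prednK.
have Pj : P (G j) by apply: IH; rewrite /= -ltnS prednK.
have -> : G i = (p i j)^-1 *: (op (G j) + (-1) *: \sum_(h | h != i) p h j *: G h).
  rewrite opG (bigD1 i) //= scaleN1r addrK scalerA mulVf ?scale1r //.
  exact: p1.
apply/PZ/PD; first exact: Pop.
apply/PZ; apply: (big_ind P) => // [|h hi].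
  by rewrite -(scale0r (G ord0)); apply: PZ.
have [hj|jh] := leqP h j.
  by apply/PZ/IH; rewrite (leq_ltn_trans hj) // /= -ltnS prednK.
rewrite p0 ?scale0r; first by rewrite -(scale0r (G ord0)); apply: PZ.
by rewrite -ij ltn_neqAle eq_sym hi ij.
Qed.

Lemma mxtrace_idem (F : fieldType) (n : nat) (B : 'M[F]_n) :
  B *m B = B -> \tr B = (\rank B)%:R.
Proof.
move=> BB; have idem : row_base B *m col_base B = 1%:M.
  apply: (row_free_inj (row_base_free B)).
  rewrite mul1mx -mulmxA mulmx_base.
  apply: (row_full_inj (col_base_full B)).
  by rewrite mulmxA mulmx_base BB.
by rewrite -{1}[B]mulmx_base mxtrace_mulC idem mxtrace1.
Qed.

Section SchemeBasics.
Variables (C : numClosedFieldType) (X : finType) (D : nat).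
Variable Y : assoc_scheme X D.
Notation n := #|X|.

Definition rel_class (a b : 'I_n) : 'I_D.+1 :=
  odflt ord0 [pick i | (enum_val a, enum_val b) \in srel Y i].

Lemma rel_classE a b i : ((enum_val a, enum_val b) \in srel Y i) = (rel_class a b == i).
Proof.
have [j [Hj uj]] := srel_partition Y (enum_val a) (enum_val b).
have -> : rel_class a b = j.
  rewrite /rel_class; case: pickP => [k /uj -> //|/(_ j)].
  by rewrite Hj.
by apply/idP/eqP => [/uj|<- //].
Qed.

Lemma rel_class_sym a b : rel_class a b = rel_class b a.
Proof.
apply/esym/eqP; rewrite -rel_classE; apply: srel_sym.
by rewrite rel_classE.
Qed.

Lemma rel_class0 a b : (rel_class a b == ord0) = (a == b).
Proof. by rewrite -rel_classE srel_diag (inj_eq enum_val_inj). Qed.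

Lemma rel_class_count a b i j :
  #|[set c | (rel_class a c == i) && (rel_class c b == j)]|
  = pnum Y (rel_class a b) i j.
Proof.
rewrite -(@pnumP _ _ Y _ i j (enum_val a) (enum_val b)) ?rel_classE //.
rewrite -(on_card_preimset (f := @enum_val X predT)); last first.
  apply: onW_bij; exact: enum_val_bij.
by apply: eq_card => c; rewrite !inE !rel_classE.
Qed.

Lemma assoc_mxE i a b : assoc_mx C Y i a b = (rel_class a b == i)%:R.
Proof. by rewrite mxE rel_classE. Qed.

Lemma bose_mesnerP B : B \in bose_mesner C Y ->
  exists b : 'I_D.+1 -> C, B = \sum_i b i *: assoc_mx C Y i.
Proof. exact: mem_span_image. Qed.

Lemma assoc_combE (b : 'I_D.+1 -> C) c d :
  (\sum_i b i *: assoc_mx C Y i) c d = b (rel_class c d).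
Proof.
rewrite summxE (bigD1 (rel_class c d)) //= mxE assoc_mxE eqxx mulr1.
rewrite big1 ?addr0 // => i; rewrite eq_sym => /negbTE ne.
by rewrite mxE assoc_mxE ne mulr0.
Qed.

Lemma bose_mesner_entry B : B \in bose_mesner C Y ->
  exists b : 'I_D.+1 -> C, forall c d, B c d = b (rel_class c d).
Proof.
by move=> /bose_mesnerP[b ->]; exists b => c d; rewrite assoc_combE.
Qed.

Lemma assoc_mx0 : assoc_mx C Y ord0 = 1%:M.
Proof. by apply/matrixP => a b; rewrite assoc_mxE rel_class0 !mxE. Qed.

Lemma assoc_mx_mul i j :
  assoc_mx C Y i *m assoc_mx C Y j
  = \sum_h (pnum Y h i j)%:R *: assoc_mx C Y h.
Proof.
apply/matrixP => a b; rewrite assoc_combE mxE -rel_class_count -sum1_card.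
rewrite natr_sum [RHS]big_mkcond /=; apply: eq_bigr => c _.
by rewrite !assoc_mxE inE; do 2!case: eqP => _ /=; rewrite ?mulr0 ?mul0r ?mulr1.
Qed.

Lemma assoc_mx_tr i : (assoc_mx C Y i)^T = assoc_mx C Y i.
Proof. by apply/matrixP => a b; rewrite mxE !assoc_mxE rel_class_sym. Qed.

Lemma bose_mesner_tr B : B \in bose_mesner C Y -> B^T = B.
Proof.
move=> /bose_mesner_entry[b Hb].
by apply/matrixP => c d; rewrite mxE !Hb rel_class_sym.
Qed.

Lemma bose_mesner_diag B a : B \in bose_mesner C Y -> n%:R * B a a = \tr B.
Proof.
move=> /bose_mesner_entry[b Hb]; rewrite /mxtrace.
have H c : B c c = b ord0 by rewrite Hb; congr b; apply/eqP; rewrite rel_class0.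
under eq_bigr do rewrite H.
by rewrite H sumr_const card_ord mulr_natl.
Qed.

Hypothesis D_gt0 : (0 < D)%N.
Hypothesis hP : P_polynomial Y.
Notation A := (assoc_mx C Y (inord 1)).

Lemma inord1 : (inord 1 : 'I_D.+1) = 1%N :> nat.
Proof. by rewrite inordK. Qed.

(* Every element of the Bose-Mesner algebra is a polynomial in A. *)
Lemma assoc_mx_ind (P : 'M[C]_n -> Prop) :
  (forall B B', P B -> P B' -> P (B + B')) -> (forall a B, P B -> P (a *: B)) ->
  (forall B, P B -> P (A *m B)) -> P 1%:M -> forall i, P (assoc_mx C Y i).
Proof.
move=> PD PZ PA P1.
apply: (three_term_ind (op := mulmx A) (p := fun h i => (pnum Y h (inord 1) i)%:R)) => //.
- by move=> i; apply: assoc_mx_mul.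
- by move=> h i ih; have [-> //] := hP h (inord 1) i; rewrite inord1 add1n ih.
- move=> h i ih; rewrite pnatr_eq0; apply/eqP.
  by have [_ H] := hP h (inord 1) i; apply: H; rewrite inord1 ih add1n eqxx.
- by rewrite assoc_mx0.
Qed.

Lemma bose_mesner_ind (P : 'M[C]_n -> Prop) :
  (forall B B', P B -> P B' -> P (B + B')) -> (forall a B, P B -> P (a *: B)) ->
  (forall B, P B -> P (A *m B)) -> P 1%:M ->
  forall B, B \in bose_mesner C Y -> P B.
Proof.
move=> PD PZ PA P1 B /bose_mesnerP[b ->].
apply: (big_ind P) => // [|i _]; last by apply/PZ/(assoc_mx_ind PD PZ PA P1).
by rewrite -(scale0r 1%:M); apply: PZ.
Qed.

Lemma stable_bose_mesner (U : {vspace 'cV[C]_n}) B :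
  stable_under A U -> B \in bose_mesner C Y -> stable_under B U.
Proof.
move=> UA; move: B; apply: bose_mesner_ind => [B B' HB HB' u uU|a B HB u uU|B HB u uU|u uU].
- by rewrite mulmxDl memvD ?HB ?HB'.
- by rewrite -scalemxAl memvZ ?HB.
- by rewrite -mulmxA UA ?HB.
- by rewrite mul1mx.
Qed.

(** For the classes i, j of a, b seen from x, the edge itself is counted by p^i_(1j), which is
    therefore nonzero; the vanishing conditions do the rest. *)
Lemma adjacent_class a b x : rel_class a b = inord 1 ->
  [/\ (rel_class x a <= (rel_class x b).+1)%N,
      (rel_class x b <= (rel_class x a).+1)%N
    & almost_bipartite Y -> rel_class x a = rel_class x b ->
      rel_class x a = D :> nat].
Proof.
move=> ab; set i := rel_class x a; set j := rel_class x b.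
have pn : pnum Y i (inord 1) j != 0%N.
  rewrite /i rel_class_sym -rel_class_count cards_eq0; apply/set0Pn; exists b.
  by rewrite inE ab eqxx /= rel_class_sym.
have Hp := hP i (inord 1) j; rewrite inord1 in Hp.
split.
- rewrite leqNgt; apply: contra pn => ji; apply/eqP.
  by case: Hp => -> //; rewrite add1n ji.
- rewrite leqNgt; apply: contra pn => ij; apply/eqP.
  by case: Hp => -> //; rewrite addn1 ij !orbT.
- move=> [flat _] eij; apply/eqP; rewrite eqn_leq -ltnS ltn_ord /=.
  by rewrite leqNgt; apply: contra pn => iD; rewrite -eij flat.
Qed.

End SchemeBasics.

(** * Primitive idempotents and Krein parameters *)

Section Idempotents.
Variables (C : numClosedFieldType) (X : finType) (D : nat).
Variable Y : assoc_scheme X D.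
Notation n := #|X|.
Variables (E : 'I_D.+1 -> 'M[C]_n) (theta : 'I_D.+1 -> C).
Variable q : 'I_D.+1 -> 'I_D.+1 -> 'I_D.+1 -> C.
Hypothesis D_gt0 : (0 < D)%N.
Hypothesis hP : P_polynomial Y.
Hypothesis hE : primitive_idempotents Y E.
Notation A := (assoc_mx C Y (inord 1)).
Hypothesis htheta : forall i, A *m E i = theta i *: E i.

Let EM i : E i \in bose_mesner C Y. Proof. by case: hE. Qed.
Let E_neq0 i : E i != 0. Proof. by case: hE. Qed.
Let Eo i j : E i *m E j = if i == j then E i else 0. Proof. by case: hE. Qed.
Let Esum : \sum_i E i = 1%:M. Proof. by case: hE. Qed.
Let E0 : E ord0 = n%:R^-1 *: const_mx 1. Proof. by case: hE. Qed.

Lemma idem_tr i : (E i)^T = E i.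
Proof. exact/bose_mesner_tr/EM. Qed.

Lemma idem_sym i a b : E i a b = E i b a.
Proof. by rewrite -{1}idem_tr mxE. Qed.

Lemma bose_mesner_scalar B j : B \in bose_mesner C Y -> exists a, B *m E j = a *: E j.
Proof.
move: B; apply: (bose_mesner_ind D_gt0 hP) => [B B' [a Ha] [b Hb]|c B [a Ha]|B [a Ha]|].
- by exists (a + b); rewrite mulmxDl Ha Hb scalerDl.
- by exists (c * a); rewrite -scalemxAl Ha scalerA.
- by exists (a * theta j); rewrite -mulmxA Ha -scalemxAr htheta scalerA.
- by exists 1; rewrite mul1mx scale1r.
Qed.

(** The conjugate of E_i is an idempotent of the Bose-Mesner algebra, so it acts on E_i by a scalar
    c with c^2 = c. If c were 0, the diagonal of the product, made of sums of |E_i(k,l)|^2, would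
    force E_i = 0. *)
Lemma idem_conj i a b : (E i a b)^* = E i a b.
Proof.
pose Ec := map_mx Num.conj (E i).
have EcM : Ec \in bose_mesner C Y.
  have [e He] := bose_mesnerP (EM i).
  have -> : Ec = \sum_k (e k)^* *: assoc_mx C Y k.
    by apply/matrixP => c d; rewrite assoc_combE mxE He assoc_combE.
  apply: memv_suml => k _; apply/memvZ/memv_span/codom_f.
have EcEc : Ec *m Ec = Ec by rewrite -map_mxM Eo eqxx.
have [c Hc] := bose_mesner_scalar i EcM.
have cc : c * c = c.
  have : Ec *m (Ec *m E i) = Ec *m E i by rewrite mulmxA EcEc.
  rewrite Hc -scalemxAr Hc scalerA => /eqP; rewrite -subr_eq0 -scalerBl scaler_eq0.
  by rewrite (negbTE (E_neq0 i)) orbF subr_eq0 => /eqP.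
have EEc : E i *m Ec = c *: E i.
  by rewrite -[LHS]trmxK trmx_mul idem_tr (bose_mesner_tr EcM) Hc linearZ /= idem_tr.
have c1 : c = 1.
  have /eqP := cc; rewrite -subr_eq0 -[X in _ - X]mulr1 -mulrBr mulf_eq0 subr_eq0.
  case/orP => /eqP // c0; move: EEc; rewrite c0 scale0r => EEc.
  case/eqP: (E_neq0 i); apply/matrixP => k l; rewrite [RHS]mxE.
  have := congr1 (fun M : 'M_n => M k k) EEc; rewrite !mxE => /eqP.
  rewrite psumr_eq0 => [/allP/(_ l)|m _].
    rewrite mem_index_enum => /(_ isT); rewrite mxE (idem_sym i l k).
    by rewrite -normCK sqrf_eq0 normr_eq0 => /eqP.
  by rewrite mxE (idem_sym i m k) -normCK exprn_ge0.
(* With c = 1, conjugating Ec E_i = E_i gives E_i Ec = Ec, while transposing it gives E_i Ec =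
   E_i. *)
have : Ec = E i.
  have := congr1 (map_mx Num.conj) Hc; rewrite c1 scale1r map_mxM.
  have -> : map_mx Num.conj Ec = E i by apply/matrixP => k l; rewrite !mxE conjCK.
  by rewrite -/Ec EEc c1 scale1r => ->.
by move=> /matrixP/(_ a b); rewrite mxE.
Qed.

Lemma theta_inj : injective theta.
Proof.
move=> i j eq_th; apply/eqP; apply: contraT => nij.
have pick k : exists u : 'cV[C]_n, E k *m u != 0.
  have [|H] := boolP [exists a, E k *m delta_mx a 0 != 0 :> 'cV[C]_n].
    by move=> /existsP[a]; exists (delta_mx a 0).
  move: H; rewrite negb_exists => /forallP H; case/eqP: (E_neq0 k).
  apply/matrixP => a b; move: (H b); rewrite negbK => /eqP/matrixP/(_ a 0).
  rewrite !mxE (bigD1 b) //= big1 ?addr0 => [|c cb].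
    by rewrite mxE !eqxx mulr1.
  by rewrite mxE (negbTE cb) mulr0.
have [u nu] := pick i; have [w nw] := pick j.
(* The line spanned by E i u + E j w is A-stable, hence E i-stable. *)
pose z := E i *m u + E j *m w; pose U := <[z]>%VS.
have UA : stable_under A U.
  move=> _ /vlineP[c ->]; rewrite -scalemxAr memvZ // mulmxDr !mulmxA !htheta.
  by rewrite -!scalemxAl -eq_th -scalerDr memvZ ?memv_line.
have := stable_bose_mesner D_gt0 hP UA (EM i) (memv_line z).
rewrite mulmxDr !mulmxA !Eo eqxx (negbTE nij) mul0mx addr0 => /vlineP[c Hc].
have := congr1 (mulmx (E j)) Hc; rewrite -scalemxAr mulmxDr !mulmxA !Eo eqxx.
rewrite eq_sym (negbTE nij) !mul0mx add0r => /esym/eqP.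
rewrite scaler_eq0 (negbTE nw) orbF => /eqP c0.
by move: nu; rewrite Hc c0 scale0r eqxx.
Qed.

Hypothesis hq : krein_parameters E q.
Hypothesis X_gt0 : (0 < n)%N.

Let n_neq0 : n%:R != 0 :> C. Proof. by rewrite pnatr_eq0 -lt0n. Qed.

Lemma krein_trace h i j :
  \tr (E h *m map2_mx *%R (E i) (E j)) = n%:R^-1 * q h i j * \tr (E h).
Proof.
rewrite hq -scalemxAr mulmx_sumr (bigD1 h) //= -scalemxAr Eo eqxx big1 ?addr0.
  by rewrite scalerA mxtraceZ.
by move=> k kh; rewrite -scalemxAr Eo eq_sym (negbTE kh) scaler0.
Qed.

Lemma idem_mul_entry i a b : \sum_c E i a c * E i c b = E i a b.
Proof.
by have := congr1 (fun M : 'M_n => M a b) (Eo i i); rewrite eqxx mxE.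
Qed.

(* The sum of the squared (real) entries of E i A*_h E j over all base
   vertices is the trace in krein_trace. *)
Lemma triple_vanish h i j y : q h i j = 0 ->
  E i *m diag_mx (\row_a E h y a) *m E j = 0.
Proof.
move=> q0; pose S y z w := \sum_a E h y a * E i z a * E j a w.
have SE y' z w : (E i *m diag_mx (\row_a E h y' a) *m E j) z w = S y' z w.
  rewrite mxE; apply: eq_bigr => a _; congr (_ * _).
  rewrite mul_mx_diag !mxE mulrC //.
have Sreal y' z w : S y' z w \is Num.real.
  apply: rpred_sum => a _; rewrite !rpredM //; apply/CrealP; exact: idem_conj.
have sum0 : \sum_y' \sum_z \sum_w S y' z w ^+ 2 = 0.
  transitivity (\tr (E h *m map2_mx *%R (E i) (E j))); last first.
    by rewrite krein_trace q0 mulr0 mul0r.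
  transitivity (\sum_a \sum_b E h a b * E i a b * E j a b); last first.
    apply: eq_bigr => a _; rewrite mxE; apply: eq_bigr => b _.
    by rewrite mxE mulrA (idem_sym i b) (idem_sym j b).
  (* Once each square is expanded over pairs (a, b), the sums over y', z and w separate, and
     idempotence collapses them to entries of E_h, E_i and E_j. *)
  transitivity (\sum_a \sum_b \sum_y' \sum_z \sum_w
      (E h y' a * E h y' b) * (E i z a * E i z b) * (E j a w * E j b w)).
    under eq_bigr => y' _.
      under eq_bigr => z _.
        under eq_bigr => w _.
          rewrite expr2 /S big_distrlr /=; over.
        rewrite exchange_big; under eq_bigr do rewrite exchange_big; over.
      rewrite exchange_big; under eq_bigr do rewrite exchange_big; over.
    rewrite exchange_big; under eq_bigr do rewrite exchange_big.
    do 5!(apply: eq_bigr => ? _); ring.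
  apply: eq_bigr => a _; apply: eq_bigr => b _.
  rewrite -[E h a b]idem_mul_entry -[E i a b]idem_mul_entry -[E j a b]idem_mul_entry.
  rewrite !mulr_suml; apply: eq_bigr => y' _.
  rewrite -[RHS]mulrA mulr_suml [RHS]mulr_sumr; apply: eq_bigr => z _.
  rewrite [RHS]mulrA [RHS]mulr_sumr; apply: eq_bigr => w _.
  by rewrite (idem_sym h a) (idem_sym i a) (idem_sym j w).
have S0 y' z w : S y' z w = 0.
  move/eqP: sum0; rewrite psumr_eq0 => [/allP/(_ y')|y'' _]; last first.
    by do 2!(apply: sumr_ge0 => ? _); rewrite real_exprn_even_ge0.
  rewrite mem_index_enum => /(_ isT); rewrite psumr_eq0 => [/allP/(_ z)|z' _]; last first.
    by apply: sumr_ge0 => ? _; rewrite real_exprn_even_ge0.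
  rewrite mem_index_enum => /(_ isT); rewrite psumr_eq0 => [/allP/(_ w)|w' _]; last first.
    by rewrite real_exprn_even_ge0.
  by rewrite mem_index_enum => /(_ isT); rewrite sqrf_eq0 => /eqP.
by apply/matrixP => z w; rewrite SE S0 mxE.
Qed.

Variable x : X.

Definition dual_assoc (h : 'I_D.+1) : 'M[C]_n :=
  diag_mx (\row_a (n%:R * E h (enum_rank x) a)).

Lemma dual_assocZ h : dual_assoc h = n%:R *: diag_mx (\row_a E h (enum_rank x) a).
Proof.
by rewrite -linearZ; congr diag_mx; apply/rowP => a; rewrite !mxE.
Qed.

Lemma dual_adjE : dual_adj E x = dual_assoc (inord 1).
Proof. by []. Qed.

Lemma dual_assoc_vanish h i j : q h i j = 0 -> E i *m dual_assoc h *m E j = 0.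
Proof.
by move=> q0; rewrite dual_assocZ -scalemxAr -scalemxAl triple_vanish ?scaler0.
Qed.

Lemma dual_assoc0 : dual_assoc ord0 = 1%:M.
Proof.
rewrite -[1%:M]/(1%:M) -diag_const_mx; congr diag_mx; apply/rowP => a.
by rewrite mxE E0 !mxE mulr1 mulfV.
Qed.

Lemma dual_assoc_mul i j :
  dual_assoc i *m dual_assoc j = \sum_h q h i j *: dual_assoc h.
Proof.
have -> : \sum_h q h i j *: dual_assoc h
  = diag_mx (\row_a (n%:R * \sum_h q h i j * E h (enum_rank x) a)).
  under eq_bigr do rewrite -linearZ; rewrite -linear_sum; congr diag_mx.
  apply/rowP => a; rewrite summxE mxE mulr_sumr; apply: eq_bigr => h _.
  by rewrite !mxE mulrCA.
rewrite mulmx_diag; congr diag_mx; apply/rowP => a; rewrite !mxE.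
have := congr1 (fun M : 'M_n => M (enum_rank x) a) (hq i j).
rewrite !mxE summxE => H; rewrite mulrACA H -!mulrA (mulVKf n_neq0).
by congr (_ * _); apply: eq_bigr => h _; rewrite mxE.
Qed.

Hypothesis hQ : Q_polynomial q.

Lemma stable_dual_assoc (U : {vspace 'cV[C]_n}) h :
  stable_under (dual_adj E x) U -> stable_under (dual_assoc h) U.
Proof.
move=> UA; move: h.
apply: (three_term_ind (P := fun B => stable_under B U)
    (op := mulmx (dual_adj E x)) (p := fun h i => q h (inord 1) i)).
- by move=> i; rewrite dual_adjE dual_assoc_mul.
- by move=> h i ih; have [-> //] := hQ h (inord 1) i; rewrite inord1 // add1n ih.
- move=> h i ih; apply/eqP.
  by have [_ H] := hQ h (inord 1) i; apply: H; rewrite inord1 // ih add1n eqxx.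
- by move=> B B' HB HB' u uU; rewrite mulmxDl memvD ?HB ?HB'.
- by move=> a B HB u uU; rewrite -scalemxAl memvZ ?HB.
- by move=> B HB u uU; rewrite -mulmxA UA ?HB.
- by rewrite dual_assoc0 => u; rewrite mul1mx.
Qed.

(** Row x of A_i = sum_h e_h E_h, placed on the diagonal, writes E*_i as a combination of the dual
    associate matrices. *)
Lemma stable_dual_idem (U : {vspace 'cV[C]_n}) i :
  stable_under (dual_adj E x) U -> stable_under (dual_idem C Y x i) U.
Proof.
move=> UA.
have AiM : assoc_mx C Y i \in bose_mesner C Y by apply/memv_span/codom_f.
have /fin_all_exists[e He] : forall h, exists a, assoc_mx C Y i *m E h = a *: E h.
  by move=> h; apply: bose_mesner_scalar.
have -> : dual_idem C Y x i = \sum_h (n%:R^-1 * e h) *: dual_assoc h.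
  under eq_bigr do rewrite -linearZ; rewrite -linear_sum; congr diag_mx.
  apply/rowP => a; rewrite mxE summxE.
  transitivity (assoc_mx C Y i (enum_rank x) a); first by rewrite mxE enum_rankK.
  rewrite -[assoc_mx C Y i]mulmx1 -Esum mulmx_sumr summxE.
  apply: eq_bigr => h _; rewrite He !mxE -mulrA mulrCA.
  by rewrite (mulrCA _ n%:R) (mulVKf n_neq0).
move=> u uU; rewrite mulmx_suml; apply: memv_suml => h _.
by rewrite -scalemxAl memvZ // stable_dual_assoc.
Qed.

End Idempotents.

(** * Dual idempotents and endpoints *)

Definition nat_family (F : fieldType) (n D : nat) (E : 'I_D.+1 -> 'M[F]_n) (i : nat)
    : 'M[F]_n := if (i <= D)%N then E (inord i) else 0.

Section NatFamily.
Variables (F : fieldType) (n D : nat) (E : 'I_D.+1 -> 'M[F]_n).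

Lemma nat_family_ord (i : 'I_D.+1) : nat_family E i = E i.
Proof. by rewrite /nat_family -ltnS ltn_ord inord_val. Qed.

Lemma nat_family_resolution :
  (forall i j, E i *m E j = if i == j then E i else 0) -> \sum_i E i = 1%:M ->
  resolution D (nat_family E).
Proof.
move=> Eo E1; split=> [i j||i Di].
- rewrite /nat_family; case: leqP => iD; last by rewrite mul0mx if_same.
  case: leqP => jD; last by rewrite mulmx0; case: eqP => // ij; move: iD; rewrite ij leqNgt jD.
  by rewrite Eo -val_eqE /= !inordK.
- by rewrite -E1; apply: eq_bigr => i _; rewrite nat_family_ord.
- by rewrite /nat_family leqNgt Di.
Qed.

Lemma nat_family_eigen (B : 'M[F]_n) (th : 'I_D.+1 -> F) :
  (forall i, B *m E i = th i *: E i) ->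
  forall i, B *m nat_family E i = th (inord i) *: nat_family E i.
Proof.
by move=> H i; rewrite /nat_family; case: leqP => _; rewrite ?H ?mulmx0 ?scaler0.
Qed.

Lemma nat_family_ind (P : 'M[F]_n -> Prop) :
  (forall i, P (E i)) -> P 0 -> forall i, P (nat_family E i).
Proof. by move=> PE P0 i; rewrite /nat_family; case: leqP. Qed.

End NatFamily.

Section DualIdempotents.
Variables (C : numClosedFieldType) (X : finType) (D : nat).
Variable Y : assoc_scheme X D.
Variable x : X.
Notation n := #|X|.
Notation A := (assoc_mx C Y (inord 1)).
Notation class := (rel_class Y (enum_rank x)).
Notation Es := (dual_idem C Y x).
Hypothesis D_gt0 : (0 < D)%N.
Hypothesis hP : P_polynomial Y.
Hypothesis hAB : almost_bipartite Y.

Lemma dual_idemE i : Es i = diag_mx (\row_a (class a == i)%:R).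
Proof.
congr diag_mx; apply/rowP => a; rewrite !mxE -rel_classE.
by rewrite enum_rankK.
Qed.

Lemma dual_idem_mulE i (u : 'cV[C]_n) a b : (Es i *m u) a b = (class a == i)%:R * u a b.
Proof. by rewrite dual_idemE mul_diag_mx !mxE. Qed.

Lemma dual_idem_orth i j : Es i *m Es j = if i == j then Es i else 0.
Proof.
rewrite !dual_idemE mulmx_diag; apply/matrixP => a b; rewrite !mxE.
case: (eqVneq i j) => [->|ij]; rewrite !mxE.
  by case: eqP => _; rewrite ?mulr1 ?mulr0.
have [ai|_] := eqVneq (class a) i; last by rewrite mul0r mul0rn.
by rewrite ai (negbTE ij) mulr0 mul0rn.
Qed.

Lemma dual_idem_sum : \sum_i Es i = 1%:M.
Proof.
apply/matrixP => a b; rewrite summxE mxE (bigD1 (class a)) //=.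
rewrite dual_idemE !mxE eqxx big1 ?addr0 // => i.
by rewrite dual_idemE !mxE eq_sym => /negbTE->; rewrite mul0rn.
Qed.

Lemma dual_idem_sandwich i j B a b :
  (Es i *m B *m Es j) a b = (class a == i)%:R * B a b * (class b == j)%:R.
Proof. by rewrite !dual_idemE mul_mx_diag mxE mul_diag_mx !mxE. Qed.

Lemma dual_idem_tri (i j : 'I_D.+1) : (i.+1 < j)%N || (j.+1 < i)%N ->
  Es i *m A *m Es j = 0.
Proof.
move=> far; apply/matrixP => a b; rewrite dual_idem_sandwich assoc_mxE [RHS]mxE.
have [ai|_] := eqVneq (class a) i; last by rewrite !mul0r.
have [bj|_] := eqVneq (class b) j; last by rewrite mulr0.
have [ab|_] := eqVneq (rel_class Y a b) (inord 1); last by rewrite mulr0 mul0r.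
have [H1 H2 _] := adjacent_class D_gt0 hP (enum_rank x) ab.
by move: far; rewrite -ai -bj !ltnNge H1 H2.
Qed.

Lemma dual_idem_flat (i : 'I_D.+1) : (i < D)%N -> Es i *m A *m Es i = 0.
Proof.
move=> iD; apply/matrixP => a b; rewrite dual_idem_sandwich assoc_mxE [RHS]mxE.
have [ai|_] := eqVneq (class a) i; last by rewrite !mul0r.
have [bi|_] := eqVneq (class b) i; last by rewrite mulr0.
have [ab|_] := eqVneq (rel_class Y a b) (inord 1); last by rewrite mulr0 mul0r.
have [_ _ H] := adjacent_class D_gt0 hP (enum_rank x) ab.
by move: iD; rewrite -ai (H hAB) ?ltnn // ai bi.
Qed.

Variables (E : 'I_D.+1 -> 'M[C]_n) (theta : 'I_D.+1 -> C).
Hypothesis hE : primitive_idempotents Y E.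
Hypothesis htheta : forall i, A *m E i = theta i *: E i.

Let EM i : E i \in bose_mesner C Y. Proof. by case: hE. Qed.
Let E_neq0 i : E i != 0. Proof. by case: hE. Qed.
Let Eo i j : E i *m E j = if i == j then E i else 0. Proof. by case: hE. Qed.
Let Esum : \sum_i E i = 1%:M. Proof. by case: hE. Qed.
Let E0 : E ord0 = n%:R^-1 *: const_mx 1. Proof. by case: hE. Qed.

(* The coefficients of E i on the associate matrices form an eigenvector of
   the intersection matrix, which is tridiagonal with zero diagonal except in
   the last place. *)
Lemma idem_recurrence i : exists e : nat -> C, exists k, (k <= D)%N /\ e k != 0 /\
  forall k : 'I_D.+1,
    (0 < k)%:R * (pnum Y k (inord 1) (inord k.-1))%:R * e k.-1
    + (k == D :> nat)%:R * (pnum Y k (inord 1) k)%:R * e k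
    + (k < D)%:R * (pnum Y k (inord 1) (inord k.+1))%:R * e k.+1
    = theta i * e k.
Proof.
have [e He] := bose_mesnerP (EM i).
have combo (b : 'I_D.+1 -> C) : \sum_k b k *: assoc_mx C Y k = 0 -> forall k, b k = 0.
  move=> H k; have /set0Pn[[y z]] := srel_neq0 Y k.
  rewrite -(enum_rankK y) -(enum_rankK z) rel_classE => /eqP <-.
  by rewrite -(assoc_combE Y b) H mxE.
exists (fun k => e (inord k)).
have [k nk] : exists k, e k != 0.
  apply/existsP; apply: contraT; rewrite negb_exists => /forallP H.
  case/eqP: (E_neq0 i); rewrite He big1 // => k _.
  by move: (H k); rewrite negbK => /eqP ->; rewrite scale0r.
exists (k : nat); rewrite -ltnS ltn_ord inord_val; split=> //; split=> // {nk k} k.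
have /combo/(_ k)/eqP : \sum_k (\sum_h e h * (pnum Y k (inord 1) h)%:R - theta i * e k)
    *: assoc_mx C Y k = 0.
  have := htheta i; rewrite {1 2}He mulmx_sumr => /eqP; rewrite -subr_eq0 => /eqP H.
  rewrite -[RHS]H; under eq_bigr do rewrite scalerBl; rewrite big_split /=.
  congr (_ + _); last first.
    by rewrite sumrN scaler_sumr; congr (- _); apply: eq_bigr => h _; rewrite scalerA.
  under [RHS]eq_bigr do rewrite -scalemxAr assoc_mx_mul scaler_sumr.
  rewrite exchange_big /=; apply: eq_bigr => h _; rewrite scaler_suml.
  by apply: eq_bigr => j _; rewrite scalerA.
rewrite subr_eq0 => /eqP; rewrite inord_val => <-.
pose f h := e (inord h) * (pnum Y k (inord 1) (inord h))%:R.
transitivity (\sum_(h < D.+1) f h); last first.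
  by apply: eq_bigr => h _; rewrite /f inord_val.
have fz (h : 'I_D.+1) : ((h.+1 < k) || (k.+1 < h))%N -> f h = 0.
  move=> far; rewrite /f inord_val.
  have [H _] := hP k (inord 1) h; rewrite H ?mulr0 // inord1 // add1n addn1.
  by case/orP: far => ->; rewrite ?orbT.
have fk : f k = (k == D :> nat)%:R * (pnum Y k (inord 1) k)%:R * e k.
  rewrite /f inord_val; case: eqP => kD; first by rewrite mul1r mulrC.
  have [H _] := hAB; rewrite H; first by rewrite mulr0 !mul0r.
  by rewrite ltn_neqAle -ltnS ltn_ord andbT; apply/eqP.
have fm : f k.-1 * (0 < k)%:R
    = (0 < k)%:R * (pnum Y k (inord 1) (inord k.-1))%:R * e (inord k.-1).
  by rewrite /f; ring.
have fp : f k.+1 * (k < D)%:R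
    = (k < D)%:R * (pnum Y k (inord 1) (inord k.+1))%:R * e (inord k.+1).
  by rewrite /f; ring.
rewrite -fm -fp -fk.
(* Each h near k meets exactly one indicator; the guard [(0 < k)] matters because [k.-1] is k when k
   = 0. *)
have -> : \sum_(h < D.+1) f h = \sum_(h < D.+1) ((h == k.-1 :> nat)%:R * (0 < k)%:R * f h
   + (h == k :> nat)%:R * f h + (h == k.+1 :> nat)%:R * f h).
  apply: eq_bigr => h _; have kD := ltn_ord k.
  have [/fz ->|near] := boolP ((h.+1 < k) || (k.+1 < h))%N; first by rewrite !mulr0 !addr0.
  have [hk|[hk|hk]] : (h.+1 = k \/ h = k :> nat \/ h = k.+1 :> nat)%N by lia.
  - have [-> -> -> ->] : [/\ (0 < k)%N, h == k.-1 :> nat, (h == k :> nat) = false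
      & (h == k.+1 :> nat) = false] by split; lia.
    by rewrite !mul1r !mul0r !addr0.
  - rewrite hk eqxx; have -> : (k == k.+1 :> nat) = false by lia.
    have [->|k0] := posnP k; first by rewrite mulr0n mulr0 !mul0r add0r mul1r addr0.
    have -> : (k == k.-1 :> nat) = false by lia.
    by rewrite !mul0r add0r mul1r addr0.
  - rewrite hk eqxx; have -> : (k.+1 == k :> nat) = false by lia.
    have -> : (k.+1 == k.-1 :> nat) = false by lia.
    by rewrite !mul0r !add0r mul1r.
have pick m c : (m <= D)%N -> \sum_(h < D.+1) (h == m :> nat)%:R * c * f h = c * f m.
  move=> mD; have mD' : (m < D.+1)%N by [].
  rewrite (bigD1 (Ordinal mD')) //= eqxx mul1r big1 ?addr0 // => h.
  by rewrite -(inj_eq val_inj) /= => /negbTE->; rewrite !mul0r.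
have pick1 m : (m <= D)%N -> \sum_(h < D.+1) (h == m :> nat)%:R * f h = f m.
  by move=> /(pick _ 1); rewrite mul1r => <-; apply: eq_bigr => h _; rewrite mulr1.
have kD := ltn_ord k.
rewrite !big_split /= (pick k.-1) 1?(pick1 k); [|lia|lia].
rewrite [f _ * (0 < k)%:R]mulrC; congr (_ + _).
case: ltnP => kD'; first by rewrite pick1 // mulr1.
rewrite mulr0 big1 // => h _; by rewrite ltn_eqF ?mul0r // (leq_trans (ltn_ord h)).
Qed.

End DualIdempotents.

(** * The intersection matrix has no two opposite eigenvalues *)

Section OppositeEigenvalues.
Variables (F : numFieldType) (D : nat) (cm cp : nat -> F) (a : F).
Hypothesis cm_neq0 : forall k, (0 < k <= D)%N -> cm k != 0.
Hypothesis cp_neq0 : forall k, (k < D)%N -> cp k != 0.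
Hypothesis a_neq0 : a != 0.

Definition eigen_sequence (th : F) (e : nat -> F) : Prop :=
  forall k, (k <= D)%N ->
    (0 < k)%:R * cm k * e k.-1 + (k == D)%:R * a * e k + (k < D)%:R * cp k * e k.+1
    = th * e k.

Lemma eigen_sequence_head th e :
  eigen_sequence th e -> e 0%N = 0 -> forall k, (k <= D)%N -> e k = 0.
Proof.
move=> rec e0 k; have [m] := ubnP k; elim: m k => // m IH [|k] km kD //.
have := rec k (ltnW kD); rewrite (ltn_eqF kD) kD (IH k) ?(ltnW kD) //.
rewrite (IH k.-1) ?mulr0 ?add0r ?mul1r; [|by lia|by lia].
by move/eqP; rewrite mulf_eq0 (negbTE (cp_neq0 kD)) => /eqP.
Qed.

Lemma eigen_sequence_last th e :
  eigen_sequence th e -> e D = 0 -> forall k, (k <= D)%N -> e k = 0.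
Proof.
move=> rec eD k kD; rewrite -(subKn kD); move: (D - k)%N => j {k kD}.
have [m] := ubnP j; elim: m j => // m IH [|j] jm; first by rewrite subn0.
have [jD|Dj] := ltnP j D; last first.
  have -> : (D - j.+1 = D - j)%N by lia.
  by apply: IH; lia.
have := rec (D - j)%N (leq_subr _ _).
rewrite subn_gt0 jD -subnS (IH j) //.
have -> : (D - j < D)%:R * cp (D - j) * e (D - j).+1 = 0.
  case: j jm jD => [|j] jm jD; first by rewrite subn0 ltnn !mul0r.
  by rewrite -subSn ?subSS; [rewrite IH ?mulr0 //; lia | lia].
rewrite !mulr0 !addr0 mul1r => /eqP; rewrite mulf_eq0 (negbTE (cm_neq0 _)).
  by move/eqP.
by rewrite subn_gt0 jD leq_subr.
Qed.

(* Up to scaling, the sequence for - th is the alternated sequence for th; the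
   last equation then forces the last entry to vanish. *)
Lemma eigen_sequence_opp th e e' :
  eigen_sequence th e -> eigen_sequence (- th) e' ->
  (exists2 k, (k <= D)%N & e k != 0) -> forall k, (k <= D)%N -> e' k = 0.
Proof.
move=> rec rec' [m mD nm].
have e0 : e 0%N != 0.
  by apply: contraNneq nm => /(eigen_sequence_head rec)/(_ m mD) ->.
(* Proportionality up to signs, cross-multiplied so that e' 0 is allowed to vanish. *)
have alt k : (k <= D)%N -> e k * e' 0%N = (-1) ^+ k * e' k * e 0%N.
  have [j] := ubnP k; elim: j k => // j IH [|k] kj kD.
    by rewrite expr0 mul1r mulrC.
  apply: (mulfI (cp_neq0 kD)).
  have := rec k (ltnW kD); have := rec' k (ltnW kD).
  rewrite (ltn_eqF kD) kD !mul0r !addr0 !mul1r => H' H.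
  have {}H' : cp k * e' k.+1 = - th * e' k - (0 < k)%:R * cm k * e' k.-1.
    by rewrite -H' addrC addKr.
  have {}H : cp k * e k.+1 = th * e k - (0 < k)%:R * cm k * e k.-1.
    by rewrite -H addrC addKr.
  rewrite mulrA H mulrBl -[th * _ * _]mulrA (IH k) ?(ltnW kD) //.
  have -> : cp k * ((-1) ^+ k.+1 * e' k.+1 * e 0%N)
          = (-1) ^+ k.+1 * (cp k * e' k.+1) * e 0%N by ring.
  rewrite H'; have [->|k0] := posnP k; first by rewrite !mulr0n expr1 expr0; ring.
  rewrite !mulr1n !mul1r -[cm k * _ * _]mulrA (IH k.-1); [|lia|lia].
  rewrite -(prednK k0) !exprS /=; ring.
have := rec D (leqnn D); have := rec' D (leqnn D).
rewrite eqxx ltnn !mul0r !addr0 !mul1r => H' H.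
have := congr1 (fun z => z * e' 0%N) H; rewrite mulrDl -!mulrA (alt D) //.
have -> : (0 < D)%:R * (cm D * (e D.-1 * e' 0%N))
        = - (-1) ^+ D * ((0 < D)%:R * cm D * e' D.-1) * e 0%N.
  have [->|D0] := posnP D; first by rewrite !mulr0n; ring.
  have -> : (-1) ^+ D = - (-1) ^+ D.-1 :> F by rewrite -{1}(prednK D0) exprS mulN1r.
  rewrite (alt D.-1) ?leq_pred // !mulr1n; ring.
have -> : (0 < D)%:R * cm D * e' D.-1 = - th * e' D - a * e' D.
  by rewrite -H' addrK.
move=> /eqP; rewrite -subr_eq0.
(* In the last row the alternated sequence has the wrong sign at the diagonal entry a; what remains
   is 2 a e_0 e'_D = 0 up to sign. *)
have -> : - (-1) ^+ D * (- th * e' D - a * e' D) * e 0%N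
   + a * ((-1) ^+ D * e' D * e 0%N) - th * ((-1) ^+ D * e' D * e 0%N)
   = 2 * a * (-1) ^+ D * e 0%N * e' D by ring.
rewrite !mulf_eq0 pnatr_eq0 /= (negbTE a_neq0) signr_eq0 (negbTE e0) /=.
by move=> /eqP /(eigen_sequence_last rec').
Qed.

End OppositeEigenvalues.

(** * The last sphere, and the endpoint against the dual endpoint *)

Section EndpointBounds.
Variables (C : numClosedFieldType) (X : finType) (D : nat).
Variable Y : assoc_scheme X D.
Variable x : X.
Notation n := #|X|.
Notation A := (assoc_mx C Y (inord 1)).
Notation class := (rel_class Y (enum_rank x)).
Notation Es := (dual_idem C Y x).
Hypothesis D_gt0 : (0 < D)%N.
Hypothesis hP : P_polynomial Y.
Hypothesis hAB : almost_bipartite Y.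
Variables (E : 'I_D.+1 -> 'M[C]_n) (theta : 'I_D.+1 -> C).
Variable q : 'I_D.+1 -> 'I_D.+1 -> 'I_D.+1 -> C.
Hypothesis hE : primitive_idempotents Y E.
Hypothesis htheta : forall i, A *m E i = theta i *: E i.
Hypothesis hq : krein_parameters E q.
Hypothesis hQ : Q_polynomial q.

Let Eo i j : E i *m E j = if i == j then E i else 0. Proof. by case: hE. Qed.
Let Esum : \sum_i E i = 1%:M. Proof. by case: hE. Qed.
Let E0 : E ord0 = n%:R^-1 *: const_mx 1. Proof. by case: hE. Qed.

(** The coefficients of E_i and E_j would be nonzero eigenvectors of one intersection matrix for
    opposite values. The case j = i says that 0 is not an eigenvalue of A. *)
Lemma theta_opp i j : theta j != - theta i.
Proof.
apply/eqP => opp.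
have [e [m [mD [em rec]]]] := idem_recurrence D_gt0 hP hAB hE htheta i.
have [e' [m' [mD' [em' rec']]]] := idem_recurrence D_gt0 hP hAB hE htheta j.
case/eqP: em'; pose cm k : C := (pnum Y (inord k) (inord 1) (inord k.-1))%:R.
pose cp k : C := (pnum Y (inord k) (inord 1) (inord k.+1))%:R.
have natP k z (f : nat -> C) : (k <= D)%N ->
    (forall k : 'I_D.+1,
    (0 < k)%:R * (pnum Y k (inord 1) (inord k.-1))%:R * f k.-1
    + (k == D :> nat)%:R * (pnum Y k (inord 1) k)%:R * f k
    + (k < D)%:R * (pnum Y k (inord 1) (inord k.+1))%:R * f k.+1
    = z * f k) ->
    (0 < k)%:R * cm k * f k.-1 + (k == D)%:R * (pnum Y ord_max (inord 1) ord_max)%:R * f k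
    + (k < D)%:R * cp k * f k.+1 = z * f k.
  move=> kD /(_ (inord k)); rewrite inordK // => <-; rewrite /cm /cp.
  have [kD'|_] := eqVneq k D; last by rewrite !mul0r.
  by rewrite (_ : inord k = ord_max :> 'I_D.+1) //; apply: val_inj; rewrite /= inordK.
apply: (@eigen_sequence_opp _ D cm cp (pnum Y ord_max (inord 1) ord_max)%:R _ _ _
  (theta i) e e' _ _ _ m' mD').
- move=> k /andP[k0 kD]; rewrite pnatr_eq0; apply/eqP.
  have [_ H] := hP (inord k) (inord 1) (inord k.-1); apply: H.
  by rewrite inord1 // !inordK; lia.
- move=> k kD; rewrite pnatr_eq0; apply/eqP.
  have [_ H] := hP (inord k) (inord 1) (inord k.+1); apply: H.
  by rewrite inord1 // !inordK; lia.
- by case: hAB => _ ?; rewrite pnatr_eq0; apply/eqP.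
- by move=> k kD; apply: natP.
- by move=> k kD; apply: natP => // l; rewrite -opp; apply: rec'.
- by exists m.
Qed.

Lemma eigen_idemr i : E i *m A = theta i *: E i.
Proof.
by rewrite -[LHS]trmxK trmx_mul assoc_mx_tr (idem_tr hE) htheta linearZ /= (idem_tr hE).
Qed.

(* If the last component of an A-eigenvector vanishes, alternating its signs
   along the spheres around x gives an eigenvector for the opposite value. *)
Lemma eigenvector_last i (u : 'cV[C]_n) :
  A *m u = theta i *: u -> u != 0 -> Es ord_max *m u != 0.
Proof.
move=> Au nu; apply/eqP => uD.
have u0 b : class b = D :> nat -> u b 0 = 0.
  move=> bD; have := congr1 (fun M : 'cV_n => M b 0) uD.
  rewrite dual_idem_mulE mxE (_ : class b = ord_max) ?eqxx ?mul1r //.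
  exact: val_inj.
pose w : 'cV[C]_n := \col_a ((-1) ^+ class a * u a 0).
have Aw : A *m w = (- theta i) *: w.
  apply/matrixP => a j; rewrite (ord1 j) mxE [RHS]mxE [w a 0]mxE.
  rewrite mulNr mulrCA.
  have := congr1 (fun M : 'cV_n => M a 0) Au; rewrite mxE [RHS]mxE => <-.
  rewrite mulr_sumr -sumrN; apply: eq_bigr => b _; rewrite [w b 0]mxE assoc_mxE.
  have [ab|_] := eqVneq (rel_class Y a b) (inord 1); last by rewrite !mul0r mulr0 oppr0.
  (* Edges inside the sphere D contribute nothing because u vanishes there; every other edge joins
     consecutive spheres and reverses the sign. *)
  rewrite !mul1r; have [bD|bD] := eqVneq (class b : nat) D; first by rewrite u0 // !mulr0 oppr0.
  have [H1 H2 H3] := adjacent_class D_gt0 hP (enum_rank x) ab.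
  have ne : class a != class b :> nat.
    by apply: contra_neq bD => /val_inj eab; rewrite -eab H3.
  have [e|e] : class b = (class a).+1 :> nat \/ class a = (class b).+1 :> nat by lia.
    by rewrite e exprS mulN1r mulNr.
  by rewrite e exprS mulN1r mulNr opprK.
have nw : w != 0.
  apply: contra_neq nu => w0; apply/matrixP => a j; rewrite (ord1 j) mxE.
  have /eqP := congr1 (fun M : 'cV_n => M a 0) w0; rewrite !mxE.
  by rewrite mulf_eq0 signr_eq0 => /eqP.
have /existsP[j nj] : [exists j, E j *m w != 0].
  apply: contraT; rewrite negb_exists => /forallP H; case/eqP: nw.
  rewrite -[w]mul1mx -Esum mulmx_suml big1 // => j _.
  by move: (H j); rewrite negbK => /eqP.
have := theta_opp i j; rewrite -subr_eq0 => /negP; apply.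
have : (theta j - - theta i) *: (E j *m w) = 0.
  by rewrite scalerBl scalemxAl -eigen_idemr -mulmxA Aw scalemxAr subrr.
by move/eqP; rewrite scaler_eq0 (negbTE nj) orbF.
Qed.

Lemma module_last (W : {vspace 'cV[C]_n}) :
  (forall i, stable_under (E i) W) -> W != 0%VS ->
  exists2 w, w \in W & Es ord_max *m w != 0.
Proof.
move=> WE W0; have wW := memv_pick W; have nw : vpick W != 0 by rewrite vpick0.
have /existsP[j nj] : [exists j, E j *m vpick W != 0].
  apply: contraT; rewrite negb_exists => /forallP H; case/eqP: nw.
  rewrite -[vpick W]mul1mx -Esum mulmx_suml big1 // => j _.
  by move: (H j); rewrite negbK => /eqP.
exists (E j *m vpick W); first exact: WE.
by apply: (@eigenvector_last j) => //; rewrite mulmxA htheta scalemxAl.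
Qed.

(** The matrix is (A - theta_1) ... (A - theta_m), each factor extending the reach in the graph by
    one. Starting the roots at theta_1 spares E_0. *)
Lemma poly_in_A m : (m <= D)%N -> exists B : 'M[C]_n,
  (forall h, B *m E h = (\prod_(k < m) (theta h - theta (inord k.+1))) *: E h) /\
  (forall a b, (m < rel_class Y a b)%N -> B a b = 0).
Proof.
elim: m => [|m IH] mD.
  exists 1%:M; split=> [h|a b]; first by rewrite mul1mx big_ord0 scale1r.
  rewrite mxE; case: eqP => // ->.
  by rewrite (_ : rel_class Y b b = ord0) //; apply/eqP; rewrite rel_class0.
have [B [BE B0]] := IH (ltnW mD).
exists ((A - (theta (inord m.+1))%:M) *m B); split=> [h|a b mab].
  rewrite -mulmxA BE -scalemxAr mulmxBl htheta mul_scalar_mx -scalerBl scalerA.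
  by rewrite big_ord_recr.
rewrite mulmxBl mul_scalar_mx !mxE (B0 a b) ?(ltnW mab) // mulr0 subr0.
apply: big1 => c _; rewrite assoc_mxE.
have [ac|_] := eqVneq (rel_class Y a c) (inord 1); last by rewrite mul0r.
have [H _ _] := adjacent_class D_gt0 hP b ac.
by rewrite B0 ?mulr0 // rel_class_sym -ltnS (leq_trans _ H) // rel_class_sym.
Qed.

(* If 2 t < r, evaluate the polynomial of degree 2 t in A that kills
   E_1, ..., E_(2 t) at row x against the weights |u_b|^2: it vanishes, since
   |u|^2 is supported outside the first r spheres, and so do all terms but the
   one of E_0, the E_h with 2 t < h being killed by q^h_tt = 0. *)
Lemma endpoint_le_double t (u : 'cV[C]_n) r :
  E t *m u = u -> u != 0 -> (r <= D)%N ->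
  (forall i : 'I_D.+1, (i < r)%N -> Es i *m u = 0) -> (r <= 2 * t)%N.
Proof.
move=> Eu nu rD ur; rewrite leqNgt; apply/negP => tr; case/eqP: nu.
pose s b := u b 0 * (u b 0)^*; pose phi h := \sum_b E h (enum_rank x) b * s b.
have n0 : (0 < n)%N by apply/card_gt0P; exists x.
(* [phi h] is the Hermitian form of u at the diagonal matrix made of row x of E_h. Since E_t u = u,
   only that matrix between two factors E_t matters, and [triple_vanish] kills it. *)
have phi0 (h : 'I_D.+1) : (2 * t < h)%N -> phi h = 0.
  move=> th; have qh : q h t t = 0.
    by have [H _] := hQ h t t; apply: H; rewrite addnn -mul2n th.
  have := triple_vanish D_gt0 hP hE htheta hq (enum_rank x) qh.
  pose ub := map_mx Num.conj u.
  have Ec : map_mx Num.conj (E t) = E t.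
    by apply/matrixP => a b; rewrite mxE (idem_conj D_gt0 hP hE htheta).
  have Eub : ub^T *m E t = ub^T.
    by rewrite -[E t](idem_tr hE) -trmx_mul -{1}Ec -map_mxM Eu.
  move/(congr1 (fun M => ub^T *m M *m u)); rewrite mulmx0 mul0mx !mulmxA Eub.
  rewrite -mulmxA Eu => /(congr1 (fun M : 'M_1 => M 0 0)); rewrite [RHS]mxE => <-.
  rewrite mxE; apply: eq_bigr => b _; rewrite mul_mx_diag !mxE /s.
  by ring.
have [B [BE B0]] := poly_in_A (leq_trans (ltnW tr) rD).
pose c h := \prod_(k < 2 * t) (theta h - theta (inord k.+1)).
have : \sum_b B (enum_rank x) b * s b = 0.
  apply: big1 => b _; have [bt|tb] := ltnP (2 * t) (class b).
    by rewrite B0 ?mul0r.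
  rewrite /s; have -> : u b 0 = 0.
    have := congr1 (fun M : 'cV_n => M b 0) (ur (class b) (leq_ltn_trans tb tr)).
    by rewrite dual_idem_mulE mxE eqxx mul1r.
  by rewrite mul0r mulr0.
have -> : \sum_b B (enum_rank x) b * s b = \sum_h c h * phi h.
  under [RHS]eq_bigr do rewrite mulr_sumr.
  rewrite exchange_big; apply: eq_bigr => b _.
  rewrite -[B]mulmx1 -Esum mulmx_sumr summxE mulr_suml; apply: eq_bigr => h _.
  by rewrite BE mxE mulrA.
rewrite (bigD1 ord0) //= big1 ?addr0 => [|h h0].
  move/eqP; rewrite mulf_eq0 => /orP[/eqP c0|/eqP p0].
    have /prodf_eq0[k _] : c ord0 == 0 by apply/eqP.
    rewrite subr_eq0 => /eqP/(theta_inj D_gt0 hP hE htheta)/(congr1 val)/=.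
    by rewrite inordK //; have := ltn_ord k; lia.
  have : \sum_b s b == 0.
    move/eqP: p0; rewrite /phi; under eq_bigr do rewrite E0 !mxE mulr1.
    by rewrite -mulr_sumr mulf_eq0 invr_eq0 pnatr_eq0 -[n == 0]negbK -lt0n n0.
  rewrite psumr_eq0 => [/allP ub0|b _]; last by rewrite mul_conjC_ge0.
  apply/matrixP => b j; rewrite (ord1 j) mxE; have := ub0 b.
  by rewrite mem_index_enum mul_conjC_eq0 => /(_ isT)/eqP.
have [ht|th] := ltnP (2 * t) h; first by rewrite phi0 ?mulr0.
have h1 : (0 < h)%N by rewrite lt0n; apply: contra h0 => /eqP h0; apply/eqP/val_inj.
have hk : (h.-1 < 2 * t)%N by rewrite prednK.
rewrite /c (bigD1 (Ordinal hk)) //= prednK // inord_val subrr mul0r mul0r //.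
Qed.

End EndpointBounds.

(** * Traces *)

Section TraceDecomposition.
Variables (F : fieldType) (n : nat).

Lemma trace_line (g : {linear 'cV[F]_n -> 'cV[F]_n}) w m :
  w != 0 -> (forall u, exists c, g u = c *: w) -> g w = m *: w ->
  \sum_a g (delta_mx a 0) a 0 = m.
Proof.
move=> nw gw Hm; have /fin_all_exists[c Hc] : forall a, exists c, g (delta_mx a 0) = c *: w.
  by move=> a; apply: gw.
have : m *: w = (\sum_a w a 0 * c a) *: w.
  rewrite -Hm {1}[w]matrix_sum_delta linear_sum /= scaler_suml.
  apply: eq_bigr => a _; rewrite big_ord1 linearZ /= Hc scalerA //.
move/eqP; rewrite -subr_eq0 -scalerBl scaler_eq0 (negbTE nw) orbF subr_eq0 => /eqP->.
by apply: eq_bigr => a _; rewrite Hc mxE mulrC.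
Qed.

(** B maps each summand into one line, so its trace there is its scalar on that line. The case w = 0
    admits the summands killed by B. *)
Lemma trace_direct_sum (N : nat) (W : 'I_N -> {vspace 'cV[F]_n}) (B : 'M[F]_n)
    (m : 'I_N -> F) :
  directv (\sum_k W k) -> (\sum_k W k)%VS = fullv ->
  (forall k, exists w, [/\ w \in W k, B *m w = m k *: w, w = 0 -> m k = 0
     & forall u, u \in W k -> exists c, B *m u = c *: w]) ->
  \tr B = \sum_k m k.
Proof.
move=> dirW fullW HB; pose pi k := sumv_pi_for (esym fullW) k.
have piW k u : pi k u \in W k by apply: memv_sum_pi.
have pi_sum u : \sum_k pi k u = u by apply: sumv_pi_sum; rewrite memvf.
have pi_id k w : w \in W k -> pi k w = w.
  move=> wW; pose us j := pi j w - (if j == k then w else 0).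
  have /directv_sum_independent/(_ us) := dirW.
  have usW j : true -> us j \in W j.
    by move=> _; rewrite memvB ?piW //; case: eqP => [->|_]; rewrite ?mem0v.
  have us0 : \sum_j us j = 0.
    by rewrite sumrB pi_sum -big_mkcond big_pred1_eq subrr.
  by move=> /(_ usW us0 k isT)/eqP; rewrite /us eqxx subr_eq0 => /eqP.
transitivity (\sum_k \sum_a (B *m pi k (delta_mx a 0)) a 0).
  rewrite exchange_big; apply: eq_bigr => a _.
  rewrite -summxE -mulmx_sumr pi_sum mxE (bigD1 a) //= mxE !eqxx mulr1.
  by rewrite big1 ?addr0 // => b ba; rewrite mxE (negbTE ba) mulr0.
apply: eq_bigr => k _; have [w [wW Bw w0 Hu]] := HB k.
have [ew|nw] := eqVneq w 0.
  rewrite (w0 ew) big1 // => a _; have [c ->] := Hu _ (piW k (delta_mx a 0)).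
  by rewrite ew scaler0 mxE.
pose g := linfun (mulmx B) \o pi k.
have gE u : g u = B *m pi k u by rewrite /g /= lfunE.
under eq_bigr do rewrite -gE.
apply: (@trace_line g w) => // [u|].
  by have [c Hc] := Hu _ (piW k u); exists c; rewrite -Hc -gE.
by rewrite -[LHS]/(g w) gE pi_id.
Qed.

End TraceDecomposition.

(** * The trace through the Krein parameters *)

Section SchemeTrace.
Variables (C : numClosedFieldType) (X : finType) (D : nat).
Variable Y : assoc_scheme X D.
Variable x : X.
Notation n := #|X|.
Hypothesis D_gt0 : (0 < D)%N.
Variables (E : 'I_D.+1 -> 'M[C]_n).
Variable q : 'I_D.+1 -> 'I_D.+1 -> 'I_D.+1 -> C.
Hypothesis hE : primitive_idempotents Y E.
Hypothesis hq : krein_parameters E q.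
Hypothesis hQ : Q_polynomial q.

Let EM i : E i \in bose_mesner C Y. Proof. by case: hE. Qed.
Let Eo i j : E i *m E j = if i == j then E i else 0. Proof. by case: hE. Qed.
Let E0 : E ord0 = n%:R^-1 *: const_mx 1. Proof. by case: hE. Qed.
Let X_gt0 : (0 < n)%N. Proof. by apply/card_gt0P; exists x. Qed.
Let n_neq0 : n%:R != 0 :> C. Proof. by rewrite pnatr_eq0 -lt0n. Qed.

Definition hadamard_power (e : nat) : 'M[C]_n :=
  map_mx (fun z => z ^+ e) (E (inord 1)).

Lemma krein_step (g : 'I_D.+1 -> C) :
  map2_mx *%R (E (inord 1)) (\sum_k g k *: E k)
  = \sum_h (n%:R^-1 * \sum_k g k * q h (inord 1) k) *: E h.
Proof.
transitivity (\sum_k g k *: map2_mx *%R (E (inord 1)) (E k)).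
  apply/matrixP => a b; rewrite mxE !summxE mulr_sumr.
  by apply: eq_bigr => k _; rewrite !mxE mulrCA.
under eq_bigr do rewrite hq scaler_sumr scaler_sumr.
rewrite exchange_big /=; apply: eq_bigr => h _.
rewrite mulr_sumr scaler_suml; apply: eq_bigr => k _.
by rewrite !scalerA mulrCA mulrA.
Qed.

Lemma krein_zero (h k : 'I_D.+1) : (k.+1 < h)%N || (h.+1 < k)%N -> q h (inord 1) k = 0.
Proof.
move=> far; have [H _] := hQ h (inord 1) k; apply: H; rewrite inord1 //.
by rewrite add1n addn1; case/orP: far => ->; rewrite ?orbT.
Qed.

Lemma hadamard_power_expand e : (e <= D)%N -> exists g : 'I_D.+1 -> C,
  [/\ hadamard_power e = \sum_h g h *: E h,
      forall h : 'I_D.+1, (e < h)%N -> g h = 0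
    & g (inord e) = n%:R * n%:R^-1 ^+ e * \prod_(k < e) cstar q k.+1].
Proof.
elim: e => [|e IH] eD.
  exists (fun h => if h == ord0 then n%:R else 0); split.
  - rewrite (bigD1 ord0) //= big1 ?addr0 => [|h /negbTE->]; last by rewrite scale0r.
    by apply/matrixP => a b; rewrite !mxE E0 !mxE expr0 mulr1 mulfV.
  - by move=> h; case: eqP => // ->.
  - rewrite (_ : inord 0 = ord0); last by apply: val_inj; rewrite /= inordK.
    by rewrite eqxx expr0 big_ord0 !mulr1.
have [g [gE g0 gtop]] := IH (ltnW eD).
exists (fun h => n%:R^-1 * \sum_k g k * q h (inord 1) k); split.
- rewrite -krein_step -gE; apply/matrixP => a b.
  by rewrite !mxE exprS.
- move=> h eh; rewrite big1 ?mulr0 // => k _.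
  have [ke|ek] := leqP k e; last by rewrite g0 ?mul0r.
  by rewrite krein_zero ?mulr0 // (leq_ltn_trans _ eh).
rewrite (bigD1 (inord e)) //= big1 ?addr0 => [|k].
  rewrite gtop big_ord_recr /= exprS /cstar /=; ring.
rewrite -val_eqE /= inordK ?(ltn_trans eD) // => ke.
have [ek|ke'] := ltnP e k; first by rewrite g0 ?mul0r.
by rewrite krein_zero ?mulr0 // inordK //; lia.
Qed.

(** Downward counterpart: each factor E_1 lowers the bottom index by one and contributes a b* over
    |X|. *)
Lemma hadamard_idem_expand e s : (s + e <= D)%N -> exists g : 'I_D.+1 -> C,
  [/\ map2_mx *%R (hadamard_power e) (E (inord (s + e))) = \sum_h g h *: E h,
      forall h : 'I_D.+1, (h < s)%N -> g h = 0
    & g (inord s) = n%:R^-1 ^+ e * \prod_(s <= k < s + e) bstar q k].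
Proof.
elim: e s => [|e IH] s seD.
  rewrite addn0 in seD *.
  exists (fun h => (h == inord s)%:R); split.
  - rewrite (bigD1 (inord s)) //= eqxx big1 ?addr0 => [|h /negbTE->]; last by rewrite scale0r.
    by apply/matrixP => a b; rewrite !mxE expr0.
  - move=> h hs; case: eqP => // hs'; move: hs.
    by rewrite hs' inordK ?ltnn.
  - by rewrite eqxx expr0 big_geq // mulr1.
have [|g [gE g0 gbot]] := IH s.+1; first by rewrite addSnnS.
have sD : (s < D)%N by lia.
exists (fun h => n%:R^-1 * \sum_k g k * q h (inord 1) k); split.
- rewrite -krein_step -gE addSnnS; apply/matrixP => a b.
  by rewrite !mxE exprS mulrA.
- move=> h hs; rewrite big1 ?mulr0 // => k _.
  have [ks|sk] := ltnP k s.+1; first by rewrite g0 ?mul0r.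
  by rewrite krein_zero ?mulr0 // (leq_trans _ sk) ?orbT.
rewrite (bigD1 (inord s.+1)) //= big1 ?addr0 => [|k].
  rewrite gbot [in RHS]big_ltn; last by rewrite -addSnnS ltnS leq_addr.
  by rewrite exprS addSnnS {2}/bstar sD; ring.
rewrite -val_eqE /= inordK ?ltnS // => ks.
have [ks'|sk] := leqP k s; first by rewrite g0 ?mul0r.
by rewrite krein_zero ?mulr0 // inordK; lia.
Qed.

Lemma dual_adj_iter e : iter e (mulmx (dual_adj E x)) 1%:M
  = diag_mx (\row_a (n%:R ^+ e * hadamard_power e (enum_rank x) a)).
Proof.
elim: e => [|e IH].
  rewrite /= -diag_const_mx; congr diag_mx; apply/rowP => a.
  by rewrite !mxE !expr0 mulr1.
rewrite /= IH mulmx_diag; congr diag_mx; apply/rowP => a; rewrite !mxE !exprS.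
by rewrite mulrACA.
Qed.

(* The trace is the diagonal entry at x of F K F up to |X|^(2 e), for the
   Hadamard products F = E_1 o ... o E_1 (e factors) and K = E_s o E_(s + e),
   and F K is a multiple of E_e. *)
Lemma dual_adj_trace s e : (s + e <= D)%N ->
  let P := iter e (mulmx (dual_adj E x)) 1%:M in
  \tr (E (inord s) *m P *m E (inord (s + e)) *m P)
  = (\rank (E (inord s)))%:R
    * \prod_(s <= h < s + e) (bstar q h * cstar q (s + e - h)).
Proof.
move=> seD P; have eD : (e <= D)%N by apply: leq_trans seD; apply: leq_addl.
have [f [fE f0 ftop]] := hadamard_power_expand eD.
have [g [gE g0 gbot]] := hadamard_idem_expand seD.
set Fe := hadamard_power e in fE gE.
pose K := map2_mx *%R (E (inord s)) (E (inord (s + e))).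
have mulE B (b : 'I_D.+1 -> C) (c : 'I_D.+1 -> C) : B = \sum_h b h *: E h ->
    B *m (\sum_h c h *: E h) = \sum_h (b h * c h) *: E h.
  move=> ->; rewrite mulmx_suml; apply: eq_bigr => h _.
  rewrite mulmx_sumr (bigD1 h) //= -scalemxAl -scalemxAr Eo eqxx scalerA.
  rewrite big1 ?addr0 // => k kh.
  by rewrite -scalemxAl -scalemxAr Eo eq_sym (negbTE kh) !scaler0.
have KE : K = \sum_h (n%:R^-1 * q h (inord s) (inord (s + e))) *: E h.
  by rewrite /K hq scaler_sumr; apply: eq_bigr => h _; rewrite scalerA.
have FK := mulE _ _ (fun h => n%:R^-1 * q h (inord s) (inord (s + e))) fE.
rewrite -KE in FK.
(* K has no part in E_h for h < e, since s and s + e differ by e, and F has none for h > e; only h =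
   e survives in F K. *)
have FKF : Fe *m K *m Fe = f (inord e) *: (Fe *m K).
  rewrite {2}fE (mulE _ _ _ FK) FK scaler_sumr; apply: eq_bigr => h _.
  rewrite scalerA [in RHS]mulrC; have [he|eh|he] := ltngtP h e.
  - have [H _] := hQ h (inord s) (inord (s + e)).
    rewrite H ?mulr0 ?mul0r // !inordK ?ltnS //; last by apply: leq_trans seD; apply: leq_addr.
    by rewrite [(h + s)%N]addnC ltn_add2l he !orbT.
  - by rewrite f0 // !mul0r.
  - by rewrite (_ : inord e = h) //; apply: val_inj; rewrite /= inordK ?ltnS.
have FKM : Fe *m K \in bose_mesner C Y.
  by rewrite FK; apply: memv_suml => h _; apply: memvZ.
have symE i a b : E i a b = E i b a by rewrite (idem_sym hE).
(* Both traces sum the same entrywise triple product, so the Hadamard factor E_(s+e) may move from K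
   to F. *)
have trFK : \tr (Fe *m K) = g (inord s) * \tr (E (inord s)).
  transitivity (\tr (E (inord s) *m map2_mx *%R Fe (E (inord (s + e))))).
    apply: eq_bigr => a _; rewrite mxE [RHS]mxE; apply: eq_bigr => b _.
    rewrite !mxE (symE _ b a) (symE (inord (s + e)) b a) (symE (inord 1) b a).
    by rewrite mulrCA.
  rewrite gE mulmx_sumr (bigD1 (inord s)) //= -scalemxAr Eo eqxx.
  rewrite big1 ?addr0 ?mxtraceZ // => h hs.
  by rewrite -scalemxAr Eo eq_sym (negbTE hs) scaler0.
transitivity (n%:R ^+ (2 * e) * (Fe *m K *m Fe) (enum_rank x) (enum_rank x)).
  rewrite /P dual_adj_iter -/Fe mxE mulr_sumr; apply: eq_bigr => a _.
  rewrite mul_mx_diag mxE [(_ *m E _) a a]mxE [(Fe *m K) _ a]mxE !mulr_suml mulr_sumr.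
  apply: eq_bigr => b _; rewrite mul_mx_diag !mxE.
  rewrite (symE (inord (s + e)) b a) (symE (inord s) b a) (symE (inord (s + e)) a b).
  rewrite (symE (inord 1) a) (symE (inord (s + e)) b a) mul2n -addnn exprD; ring.
have := bose_mesner_diag (enum_rank x) FKM; rewrite trFK => HD.
have mulx : (Fe *m K) (enum_rank x) (enum_rank x)
    = n%:R^-1 * (g (inord s) * \tr (E (inord s))) by rewrite -HD mulKf.
rewrite FKF mxE mulx ftop gbot mxtrace_idem ?Eo ?eqxx //.
have -> : \prod_(s <= h < s + e) (bstar q h * cstar q (s + e - h))
    = \prod_(s <= h < s + e) bstar q h * \prod_(k < e) cstar q k.+1.
  rewrite big_split /=; congr (_ * _).
  rewrite big_nat_rev /= -{1}[s]add0n big_addn addKn big_mkord.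
  by apply: eq_bigr => k _; congr cstar; have := ltn_ord k; lia.
rewrite mul2n -addnn exprD.
(* The powers of |X| cancel: 2e from the two A*^e, 1 - e from f, -e from g and -1 from the diagonal
   entry. *)
transitivity ((n%:R * n%:R^-1) * (n%:R * n%:R^-1) ^+ e * (n%:R * n%:R^-1) ^+ e
   * ((\rank (E (inord s)))%:R
   * (\prod_(s <= h < s + e) bstar q h * \prod_(k < e) cstar q k.+1))).
  by rewrite !exprMn; ring.
by rewrite divff // !expr1n !mul1r.
Qed.

End SchemeTrace.

(** * Irreducible modules *)

Lemma bigminn_eq (D t : nat) (P : pred 'I_D.+1) :
  (t <= D)%N -> (forall i : 'I_D.+1, P i -> (t <= i)%N) -> P (inord t) ->
  \big[minn/D]_(i < D.+1 | P i) (i : nat) = t.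
Proof.
move=> tD minP Pt; apply/eqP; rewrite eqn_leq; apply/andP; split; last first.
  by apply: (big_ind (fun m => t <= m)%N) => // a b ta tb; rewrite leq_min ta.
have : inord t \in index_enum 'I_D.+1 by rewrite mem_index_enum.
rewrite -[X in (_ <= X)%N](@inordK D t) //; move: (inord t) Pt => i Pi.
elim: (index_enum _) => // j s IH; rewrite inE big_cons => /predU1P[<-|/IH le_i].
  by rewrite Pi geq_minl.
by case: (P j) => //; rewrite (leq_trans (geq_minr _ _)).
Qed.

Lemma shifted_prod_nseq (F : fieldType) (n : nat) (B : 'M[F]_n) e u :
  shifted_prod B (nseq e 0) u = iter e (mulmx B) u.
Proof. by elim: e => // e IH; rewrite [nseq _ _]/= shifted_prod_cons IH scale0r subr0. Qed.

Section Module.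
Variables (C : numClosedFieldType) (X : finType) (D : nat).
Variable Y : assoc_scheme X D.
Variables (E : 'I_D.+1 -> 'M[C]_#|X|).
Variable q : 'I_D.+1 -> 'I_D.+1 -> 'I_D.+1 -> C.
Variables theta thetas : 'I_D.+1 -> C.
Variable x : X.
Notation A := (assoc_mx C Y (inord 1)).
Notation As := (dual_adj E x).
Notation Es := (dual_idem C Y x).
Hypothesis D_gt0 : (0 < D)%N.
Hypothesis hP : P_polynomial Y.
Hypothesis hAB : almost_bipartite Y.
Hypothesis hE : primitive_idempotents Y E.
Hypothesis hq : krein_parameters E q.
Hypothesis hQ : Q_polynomial q.
Hypothesis htheta : forall i, A *m E i = theta i *: E i.
Hypothesis hthetas : forall i, As *m Es i = thetas i *: Es i.

Let X_gt0 : (0 < #|X|)%N. Proof. by apply/card_gt0P; exists x. Qed.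

(** A and A* generate the Terwilliger algebra, so irreducibility can be tested on subspaces stable
    under these two alone. *)
Lemma stable_terwilliger (U : {vspace 'cV[C]_#|X|}) :
  stable_under A U -> stable_under As U -> terw_module Y x U.
Proof.
move=> UA UAs B; elim=> {B} [B BM|B BM|B B' _ HB _ HB'|c B _ HB|B B' _ HB _ HB'] v vU.
- exact: (stable_bose_mesner D_gt0 hP UA BM).
- have [b ->] := mem_span_image BM; rewrite mulmx_suml; apply: memv_suml => i _.
  rewrite -scalemxAl memvZ //.
  exact: (stable_dual_idem D_gt0 hP hE htheta hq X_gt0 hQ i UAs).
- by rewrite mulmxDl memvD ?HB ?HB'.
- by rewrite -scalemxAl memvZ ?HB.
- by rewrite -mulmxA HB ?HB'.
Qed.

Lemma idem_tri i j : (i.+1 < j)%N || (j.+1 < i)%N ->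
  nat_family E i *m As *m nat_family E j = 0.
Proof.
move=> far; rewrite /nat_family; case: leqP => iD; last by rewrite !mul0mx.
case: leqP => jD; last by rewrite mulmx0.
rewrite dual_adjE (dual_assoc_vanish D_gt0 hP hE htheta hq) //.
have [H _] := hQ (inord 1) (inord i) (inord j); apply: H.
by rewrite inord1 // !inordK // !add1n; case/orP: far => ->; rewrite ?orbT.
Qed.

(* The trace of E_s P E_(s + e) P on W is read off a thin vector v. *)
Lemma module_trace (W : {vspace 'cV[C]_#|X|}) s e t dd v :
  (forall B, terwilliger Y x B -> stable_under B W) -> (s + e <= D)%N ->
  thin_data As (nat_family E) theta thetas W t dd v ->
  let P := iter e (mulmx As) 1%:M in
  let m := if Upsilon_le t dd s e then
      \prod_(s - t <= h < s - t + e)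
        (bstar_mod theta thetas t dd h * cstar_mod theta thetas t dd h.+1)
    else 0 in
  let B := E (inord s) *m P *m E (inord (s + e)) *m P in
  exists w, [/\ w \in W, B *m w = m *: w, w = 0 -> m = 0
     & forall u, u \in W -> exists c, B *m u = c *: w].
Proof.
move=> TW seD [tD vW supp comp act] P m B.
have resE : resolution D (nat_family E).
  by apply: nat_family_resolution; case: hE.
have sD : (s <= D)%N by apply: leq_trans seD; apply: leq_addr.
have EN k : (k <= D)%N -> E (inord k) = nat_family E k.
  by rewrite /nat_family => ->.
have Pit (u : 'cV[C]_#|X|) : P *m u = iter e (mulmx As) u.
  rewrite /P; elim: (e) => [|k IH] /=; first by rewrite mul1mx.
  by rewrite -mulmxA IH.
have PW : stable_under P W.
  have AsW : stable_under As W.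
    move=> u uW; rewrite -[As]mulmx1 -(@dual_idem_sum C _ _ Y x) mulmx_sumr mulmx_suml.
    apply: memv_suml => i _; rewrite hthetas -scalemxAl memvZ //.
    by apply: TW => //; apply/terwilliger_dual/memv_span/codom_f.
  move=> u uW; rewrite Pit; elim: (e) => //= k IH; exact: AsW.
have EW i : stable_under (E i) W.
  by apply: TW; apply: terwilliger_bm; case: hE.
have BE u : B *m u = E (inord s) *m (P *m (E (inord (s + e)) *m (P *m u))).
  by rewrite /B !mulmxA.
have comp0 k u : (k <= D)%N -> u \in W -> ~~ (t <= k <= t + dd)%N ->
    E (inord k) *m u = 0.
  move=> kD uW; rewrite -supp negbK EN // => /eqP H0.
  by have [c ->] := comp k u uW; rewrite H0 scaler0.
rewrite /m /Upsilon_le; case: ifP => [/andP[ts se]|/negbT far]; last first.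
  (* Here s < t or t + dd < s + e, so E_s or E_(s+e) vanishes on W and B is 0 there. *)
  exists 0; rewrite mem0v mulmx0 scaler0; split=> // u uW; exists 0.
  rewrite scaler0 BE; move: far; rewrite negb_and -!ltnNge => /orP[st|sd].
    by rewrite comp0 //; [apply/PW/EW/PW | rewrite leqNgt st].
  rewrite (comp0 (s + e)%N) ?mulmx0 //; first exact: PW.
  by rewrite [(s + e <= _)%N]leqNgt sd andbF.
exists (nat_family E s *m v); rewrite -EN //.
have EsW' : E (inord s) *m v \in W by apply: EW.
split=> //.
(* The climb collects the c*, the descent the b*; the module coefficients count from the dual
   endpoint t, hence the shift of the range by t. *)
- have /(_ (nseq e 0) s) up := shifted_prod_top resE idem_tri (v := v)
    (c := fun k => cstar_mod theta thetas t dd (k - t).+1).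
  rewrite size_nseq shifted_prod_nseq in up.
  have /(_ e s) down := iter_bottom resE idem_tri (v := v)
    (b := fun k => bstar_mod theta thetas t dd (k - t)).
  rewrite BE !EN // (Pit (nat_family E s *m v)) up => [|k kse]; last first.
    by have [|H _] := act k; [lia | apply: H].
  rewrite -!scalemxAr Pit down => [|k kse]; last first.
    by have [|_ H] := act k; [lia | apply: H].
  rewrite scalerA mulrC -big_split /=; congr (_ *: _).
  rewrite -{1}(subnK ts) big_addn.
  have -> : (s + e - t = s - t + e)%N by lia.
  by apply: eq_bigr => k _; rewrite addnK.
- move/eqP; rewrite EN // (negbTE (_ : nat_family E s *m v != 0)) //.
  by rewrite supp ts /=; lia.
- move=> u uW; rewrite BE EN //; apply: comp.
  by apply/PW/EW/PW.
Qed.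

Lemma module_parameters (W : {vspace 'cV[C]_#|X|}) :
  irr_terw_module Y x W -> exists v,
  [/\ Upsilon D (dual_endpoint E W) (diameter Y x W)
    & thin_data As (nat_family E) theta thetas W (dual_endpoint E W)
        (diameter Y x W) v].
Proof.
move=> [TW W0 irrW].
have TW' B : terwilliger Y x B -> stable_under B W by move=> HB u; apply: TW.
have resE : resolution D (nat_family E).
  by apply: nat_family_resolution; case: hE.
have resEs : resolution D (nat_family Es).
  by apply: nat_family_resolution; [apply: dual_idem_orth | apply: dual_idem_sum].
have EW i : stable_under (E i) W.
  by apply: TW'; apply: terwilliger_bm; case: hE.
have EsW i : stable_under (Es i) W.
  by apply: TW'; apply/terwilliger_dual/memv_span/codom_f.
have ENW : forall i, stable_under (nat_family E i) W.
  by apply: (nat_family_ind (P := fun B => stable_under B W)) => // u _; rewrite mul0mx mem0v.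
have EsNW : forall i, stable_under (nat_family Es i) W.
  by apply: (nat_family_ind (P := fun B => stable_under B W)) => // u _; rewrite mul0mx mem0v.
have irr (U : {vspace 'cV[C]_#|X|}) : (U <= W)%VS -> stable_under A U ->
    stable_under As U -> U = 0%VS \/ U = W.
  by move=> UW UA UAs; apply: irrW => //; apply: stable_terwilliger.
have th_inj i j : (i <= D)%N -> (j <= D)%N -> theta (inord i) = theta (inord j) -> i = j.
  move=> iD jD /(theta_inj D_gt0 hP hE htheta)/(congr1 val).
  by rewrite /= !inordK.
have triA i j : (i.+1 < j)%N || (j.+1 < i)%N ->
    nat_family Es i *m A *m nat_family Es j = 0.
  move=> far; rewrite /nat_family; case: leqP => iD; last by rewrite !mul0mx.
  case: leqP => jD; last by rewrite mulmx0.
  by rewrite dual_idem_tri // !inordK.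
have flatA i : (i < D)%N -> nat_family Es i *m A *m nat_family Es i = 0.
  move=> iD; rewrite /nat_family (ltnW iD) dual_idem_flat // inordK //.
  exact: ltnW.
have lastW : exists2 w, w \in W & nat_family Es D *m w != 0.
  have [w wW nw] := module_last x D_gt0 hP hAB hE htheta EW W0.
  exists w => //; rewrite /nat_family leqnn (_ : inord D = ord_max) //.
  by apply: val_inj; rewrite /= inordK.
have AE := nat_family_eigen htheta; have AsEs := nat_family_eigen hthetas.
have [r rD suppEs] := endpoint_support D_gt0 resE resEs AE AsEs triA ENW EsNW irr lastW.
have [t [dd [v [rdd data]]]] := thin_structure D_gt0 resE resEs AE AsEs th_inj
  idem_tri triA flatA ENW EsNW irr lastW rD suppEs.
have [tdD vW supp comp _] := data.
have Ev (i : 'I_D.+1) : (mximg (E i) W != 0%VS) = (t <= i <= t + dd)%N.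
  rewrite -supp; apply/limg_mulmx_neq0P/idP => [[w wW nw]|nv].
    apply: contra_neq nw => H0; rewrite -(nat_family_ord E).
    by have [c ->] := comp i w wW; rewrite H0 scaler0.
  by exists v => //; rewrite -(nat_family_ord E).
have tD : (t <= D)%N by apply: leq_trans tdD; apply: leq_addr.
have -> : dual_endpoint E W = t.
  apply: bigminn_eq => // [i|]; rewrite Ev; first by case/andP.
  by rewrite inordK // leqnn leq_addr.
have -> : diameter Y x W = dd.
  have -> : diameter Y x W = #|[set i : 'I_D.+1 | (r <= i)%N]|.-1.
    congr (_.-1); apply: eq_card => i; rewrite !inE.
    apply/limg_mulmx_neq0P/idP => [[w wW nw]|ri].
      have /suppEs/andP[] // : exists2 w, w \in W & nat_family Es i *m w != 0.
      by exists w => //; rewrite nat_family_ord.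
    have /suppEs[w wW nw] : (r <= i <= D)%N by rewrite ri -ltnS ltn_ord.
    by exists w => //; rewrite -(nat_family_ord Es).
  rewrite -sum1_card; under eq_bigl do rewrite inE.
  rewrite -(big_geq_mkord r D.+1 xpredT (fun=> 1%N)) sum_nat_const_nat muln1; lia.
exists v; split=> //; rewrite /Upsilon; apply/and3P; split; [lia| |lia].
rewrite -rdd addnK.
(* E_t v tests the bound r <= 2 t: it is nonzero, and being in W it vanishes on the spheres below
   r. *)
have Et : E (inord t) *m (E (inord t) *m v) = E (inord t) *m v.
  by rewrite mulmxA; case: hE => _ _ -> _ _; rewrite eqxx.
have := endpoint_le_double (x := x) D_gt0 hP hE htheta hq hQ Et (r := r).
rewrite inordK //; apply=> //.
  by have := supp t; rewrite /nat_family tD leqnn leq_addr => ->.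
move=> i ir; apply/eqP; apply: contraT => nz.
have /suppEs : exists2 w, w \in W & nat_family Es i *m w != 0.
  by exists (E (inord t) *m v); [apply: EW | rewrite nat_family_ord].
by rewrite leqNgt ir.
Qed.

End Module.

Theorem theorem16p6 (R : realType) (X : finType) (D : nat)
    (Y : assoc_scheme X D)
    (E : 'I_D.+1 -> 'M[R[i]]_#|X|)
    (q : 'I_D.+1 -> 'I_D.+1 -> 'I_D.+1 -> R[i])
    (theta thetas : 'I_D.+1 -> R[i])
    (x : X)
    (N : nat) (W : 'I_N -> {vspace 'cV[R[i]]_#|X|})
    (hD : (3 <= D)%N)
    (hP : P_polynomial Y)
    (hAB : almost_bipartite Y)
    (hE : primitive_idempotents Y E)
    (hq : krein_parameters E q)
    (hQ : Q_polynomial q)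
    (htheta : forall i, assoc_mx R[i] Y (inord 1) *m E i = theta i *: E i)
    (hthetas : forall i,
       dual_adj E x *m dual_idem R[i] Y x i = thetas i *: dual_idem R[i] Y x i)
    (hW : orthogonal_decomposition Y x W)
    (t d : nat) (htd : Upsilon D t d) :
  (\rank (E (inord t)))%:R
    * \prod_(t <= h < t + d) (bstar q h * cstar q (t + d - h))
  = \sum_(u : 'I_D.+1 * 'I_D.+1 | Upsilon D u.1 u.2
                                   && Upsilon_le u.1 u.2 t d)
      (module_mult Y E x W u.1 u.2)%:R
      * \prod_(t - u.1 <= h < t - u.1 + d)
          (bstar_mod theta thetas u.1 u.2 h
           * cstar_mod theta thetas u.1 u.2 h.+1).
Proof.
have D_gt0 : (0 < D)%N by apply: leq_trans hD.
have tdD : (t + d <= D)%N by move: htd => /and3P[dD _ tD]; lia.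
have [irrW _ dirW fullW] := hW.
rewrite -(dual_adj_trace x D_gt0 hE hq hQ tdD).
pose T k := dual_endpoint E (W k); pose L k := diameter Y x (W k).
pose p (a b : nat) := \prod_(t - a <= h < t - a + d)
  (bstar_mod theta thetas a b h * cstar_mod theta thetas a b h.+1).
have UTL k : Upsilon D (T k) (L k).
  have [v [H _]] := module_parameters D_gt0 hP hAB hE hq hQ htheta hthetas (irrW k).
  exact: H.
rewrite (trace_direct_sum (m := fun k => if Upsilon_le (T k) (L k) t d
  then p (T k) (L k) else 0) dirW fullW) => [|k]; last first.
  have [v [_ data]] := module_parameters D_gt0 hP hAB hE hq hQ htheta hthetas (irrW k).
  apply: (module_trace D_gt0 hP hE hq hQ htheta hthetas _ tdD data).
  by move=> B HB u; have [TW _ _] := irrW k; apply: TW.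
(* Summands are grouped by dual endpoint and diameter; as this pair lies in Upsilon, each summand
   preceding (t,d) is counted for exactly one u. *)
transitivity (\sum_(u : 'I_D.+1 * 'I_D.+1 | Upsilon D u.1 u.2 && Upsilon_le u.1 u.2 t d)
    \sum_(k < N) ((T k == u.1) && (L k == u.2))%:R * p u.1 u.2); last first.
  apply: eq_bigr => u _; rewrite -mulr_suml -natr_sum /module_mult; congr (_%:R * _).
  by rewrite -sum1_card [RHS]big_mkcond; apply: eq_bigr => k _; rewrite inE; case: andP.
rewrite exchange_big; apply: eq_bigr => k _.
have [Lk Tk] : (L k < D.+1)%N /\ (T k < D.+1)%N by move: (UTL k) => /and3P[]; lia.
rewrite big_mkcond (bigD1 (Ordinal Tk, Ordinal Lk)) //= UTL !eqxx mul1r big1 ?addr0 //.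
move=> [a b]; rewrite xpair_eqE -!val_eqE /= (eq_sym (T k)) (eq_sym (L k)) => /negbTE->.
by rewrite mul0r if_same.
Qed.
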